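(* If $V=L$ holds, and there exist unfoldable and subtle cardinals, then the first unfoldable cardinal is bigger than the first subtle cardinal.
   Context: $\mathcal{R}(\kappa)=V_\kappa$ is the set of all sets of rank less than $\kappa$. For structures $\mathfrak{A}=(M,E,\dots)$ and $\mathfrak{B}=(N,F,\dots)$ in the same language, $\mathfrak{B}$ is an end elementary extension (eee) of $\mathfrak{A}$, written $\mathfrak{A}\prec_e\mathfrak{B}$, if $\mathfrak{B}$ is a proper elementary extension of $\mathfrak{A}$ and for every $a\in M$, $\{b\in M : bEa\}=\{b\in N: bFa\}$. $o(M)$ denotes the ordinal height of $M$. A cardinal $\kappa$ is unfoldable if it is inaccessible and for every ordinal $\alpha$ and every $S\subset\mathcal{R}(\kappa)$ there is a well-founded eee $M$ of $(\mathcal{R}(\kappa),\in,S)$ with $o(M)\geq\alpha$. An inaccessible cardinal $\theta$ is subtle if for any sequence $(S_\alpha)_{\alpha<\theta}$ with each $S_\alpha\subset\alpha$ and any club $C\subset\theta$, there are $\beta<\gamma$, both in $C$, such that $S_\gamma\cap\beta=S_\beta$. *)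

(* Defs.v *)
(* A theorem "ZFC proves phi" is rendered semantically: phi holds in every
   model (U, ∈) of first-order ZFC.  The set-theoretic notions below are
   interpreted inside such a model; each of them quantifies only over elements
   of U, so it is (the truth in U of) a first-order formula in ∈. *)

Set Implicit Arguments.
Unset Strict Implicit.

Record membership_structure := MembershipStructure {
  carrier :> Type;
  mem : carrier -> carrier -> Prop
}.

Notation "x ∈ y" := (mem x y) (at level 70, no associativity).

(** * First-order formulas of set theory and the axioms of ZFC *)

(* De Bruijn indices; equality is interpreted as equality of U. *)
Inductive fo_formula : Type :=
| FMem : nat -> nat -> fo_formula
| FEq : nat -> nat -> fo_formula
| FFalse : fo_formula
| FImp : fo_formula -> fo_formula -> fo_formula
| FAll : fo_formula -> fo_formula.

Definition scons {A : Type} (a : A) (e : nat -> A) (n : nat) : A :=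
  match n with
  | O => a
  | S m => e m
  end.

Fixpoint holds {U : membership_structure} (e : nat -> U) (phi : fo_formula) : Prop :=
  match phi with
  | FMem i j => e i ∈ e j
  | FEq i j => e i = e j
  | FFalse => False
  | FImp p q => holds e p -> holds e q
  | FAll p => forall a : U, holds (scons a e) p
  end.

Definition is_empty {U : membership_structure} (x : U) : Prop :=
  forall z, ~ z ∈ x.

Definition subset {U : membership_structure} (x y : U) : Prop :=
  forall z, z ∈ x -> z ∈ y.

Definition is_succ {U : membership_structure} (y x : U) : Prop :=
  forall z, z ∈ y <-> z ∈ x \/ z = x.

Definition inductive {U : membership_structure} (I : U) : Prop :=
  (forall z, is_empty z -> z ∈ I) /\
  (forall x y, x ∈ I -> is_succ y x -> y ∈ I).

(* The environment e supplies the parameters of the two schemas. *)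
Record ZFC (U : membership_structure) : Prop := {
  ax_extensionality :
    forall x y : U, (forall z, z ∈ x <-> z ∈ y) -> x = y;
  ax_foundation :
    forall x : U, (exists y, y ∈ x) ->
      exists y, y ∈ x /\ forall z, z ∈ y -> ~ z ∈ x;
  ax_pairing :
    forall a b : U, exists p, forall z, z ∈ p <-> z = a \/ z = b;
  ax_union :
    forall x : U, exists u, forall z, z ∈ u <-> exists y, y ∈ x /\ z ∈ y;
  ax_powerset :
    forall x : U, exists p, forall z, z ∈ p <-> subset z x;
  ax_infinity :
    exists I : U, inductive I;
  ax_separation :
    forall (phi : fo_formula) (e : nat -> U) (x : U),
      exists y, forall z, z ∈ y <-> z ∈ x /\ holds (scons z e) phi;
  ax_replacement :
    forall (phi : fo_formula) (e : nat -> U) (x : U),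
      (forall u v v', u ∈ x ->
         holds (scons u (scons v e)) phi ->
         holds (scons u (scons v' e)) phi -> v = v') ->
      exists y, forall v,
        v ∈ y <-> exists u, u ∈ x /\ holds (scons u (scons v e)) phi;
  ax_choice :
    forall x : U,
      (forall y, y ∈ x -> exists z, z ∈ y) ->
      (forall y y' z, y ∈ x -> y' ∈ x -> z ∈ y -> z ∈ y' -> y = y') ->
      exists c, forall y, y ∈ x ->
        exists z, (z ∈ c /\ z ∈ y) /\
          forall z', z' ∈ c -> z' ∈ y -> z' = z
}.

(** * Pairs, relations, functions *)

Definition is_upair {U : membership_structure} (p a b : U) : Prop :=
  forall z, z ∈ p <-> z = a \/ z = b.

Definition is_pair {U : membership_structure} (p a b : U) : Prop :=
  exists u v, is_upair u a a /\ is_upair v a b /\ is_upair p u v.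

Definition rel {U : membership_structure} (r a b : U) : Prop :=
  exists p, is_pair p a b /\ p ∈ r.

Definition fun_on {U : membership_structure} (f A : U) : Prop :=
  (forall p, p ∈ f -> exists a b, a ∈ A /\ is_pair p a b) /\
  (forall a, a ∈ A -> exists b, rel f a b) /\
  (forall a b b', rel f a b -> rel f a b' -> b = b').

Definition is_fun {U : membership_structure} (f A B : U) : Prop :=
  fun_on f A /\ forall a b, rel f a b -> b ∈ B.

Definition injective {U : membership_structure} (f : U) : Prop :=
  forall a a' b, rel f a b -> rel f a' b -> a = a'.

Definition is_powerset {U : membership_structure} (p x : U) : Prop :=
  forall z, z ∈ p <-> subset z x.

(** * Ordinals, cardinals, rank *)

Definition transitive {U : membership_structure} (x : U) : Prop :=
  forall y, y ∈ x -> subset y x.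

(* Under Foundation, membership well-orders every transitive set of transitive
   sets. *)
Definition ordinal {U : membership_structure} (x : U) : Prop :=
  transitive x /\ forall y, y ∈ x -> transitive y.

Definition is_nat {U : membership_structure} (n : U) : Prop :=
  forall I, inductive I -> n ∈ I.

Definition is_omega {U : membership_structure} (w : U) : Prop :=
  forall n, n ∈ w <-> is_nat n.

Definition cardinal {U : membership_structure} (k : U) : Prop :=
  ordinal k /\
  forall l f, l ∈ k -> ~ (is_fun f k l /\ injective f).

Definition regular {U : membership_structure} (k : U) : Prop :=
  forall l f, l ∈ k -> is_fun f l k ->
    exists b, b ∈ k /\ forall x y, rel f x y -> y ∈ b.

Definition strong_limit {U : membership_structure} (k : U) : Prop :=
  forall l p, l ∈ k -> is_powerset p l ->
    exists m f, m ∈ k /\ is_fun f p m /\ injective f.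

Definition inaccessible {U : membership_structure} (k : U) : Prop :=
  cardinal k /\ (exists w, is_omega w /\ w ∈ k) /\ regular k /\ strong_limit k.

(* r is the rank function on a transitive set containing x:
   rank(y) = sup {rank(z) + 1 : z ∈ y}. *)
Definition has_rank {U : membership_structure} (x rho : U) : Prop :=
  exists t r,
    transitive t /\ x ∈ t /\ fun_on r t /\ rel r x rho /\
    forall y s, rel r y s ->
      forall d, d ∈ s <->
        exists z s', z ∈ y /\ rel r z s' /\ (d ∈ s' \/ d = s').

Definition is_R {U : membership_structure} (k X : U) : Prop :=
  forall x, x ∈ X <-> exists rho, rho ∈ k /\ has_rank x rho.

(** * Formulas and satisfaction internal to U

    The structures are triples (M, F, P) of sets: a domain, a binary relation
    and a unary predicate.  Formulas are coded by the triples
      (0,i,j) : v_i F v_j      (1,i,j) : v_i = v_j      (2,i,i) : P v_i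
      (3,a,b) : ~ (a /\ b)     (4,i,a) : exists v_i, a
    with i, j natural numbers of U, and are evaluated at assignments omega -> M.
    Codes and assignments are those of U, standard or not. *)

Fixpoint is_numeral {U : membership_structure} (n : nat) (x : U) : Prop :=
  match n with
  | O => is_empty x
  | S m => exists y, is_numeral m y /\ is_succ x y
  end.

Definition is_code {U : membership_structure} (tag : nat) (c a b : U) : Prop :=
  exists n p, is_numeral tag n /\ is_pair p a b /\ is_pair c n p.

Definition formula_closed {U : membership_structure} (X : U) : Prop :=
  (forall i j c, is_nat i -> is_nat j -> is_code 0 c i j -> c ∈ X) /\
  (forall i j c, is_nat i -> is_nat j -> is_code 1 c i j -> c ∈ X) /\
  (forall i c, is_nat i -> is_code 2 c i i -> c ∈ X) /\
  (forall a b c, a ∈ X -> b ∈ X -> is_code 3 c a b -> c ∈ X) /\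
  (forall i a c, is_nat i -> a ∈ X -> is_code 4 c i a -> c ∈ X).

Definition is_formula {U : membership_structure} (c : U) : Prop :=
  forall X, formula_closed X -> c ∈ X.

Definition assignment {U : membership_structure} (s M : U) : Prop :=
  exists w, is_omega w /\ is_fun s w M.

Definition is_update {U : membership_structure} (s' s i a : U) : Prop :=
  forall j b, rel s' j b <-> (j = i /\ b = a) \/ (j <> i /\ rel s j b).

(* Tarski's clauses for a set T of pairs (formula, assignment). *)
Definition is_satisfaction {U : membership_structure} (T M F P : U) : Prop :=
  forall s, assignment s M ->
    (forall i j c, is_nat i -> is_nat j -> is_code 0 c i j ->
       (rel T c s <-> exists a b, rel s i a /\ rel s j b /\ rel F a b)) /\
    (forall i j c, is_nat i -> is_nat j -> is_code 1 c i j ->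
       (rel T c s <-> exists a, rel s i a /\ rel s j a)) /\
    (forall i c, is_nat i -> is_code 2 c i i ->
       (rel T c s <-> exists a, rel s i a /\ a ∈ P)) /\
    (forall f g c, is_formula f -> is_formula g -> is_code 3 c f g ->
       (rel T c s <-> ~ (rel T f s /\ rel T g s))) /\
    (forall i f c, is_nat i -> is_formula f -> is_code 4 c i f ->
       (rel T c s <-> exists a s', a ∈ M /\ assignment s' M /\
                        is_update s' s i a /\ rel T f s')).

Definition models {U : membership_structure} (M F P c s : U) : Prop :=
  exists T, is_satisfaction T M F P /\ rel T c s.

Definition is_structure {U : membership_structure} (M F P : U) : Prop :=
  (exists a, a ∈ M) /\
  (forall p, p ∈ F -> exists a b, a ∈ M /\ b ∈ M /\ is_pair p a b) /\
  subset P M.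

Definition is_mem_relation {U : membership_structure} (E M : U) : Prop :=
  forall p, p ∈ E <-> exists a b, a ∈ M /\ b ∈ M /\ a ∈ b /\ is_pair p a b.

(** * The constructible hierarchy *)

(* D is the set of subsets of A definable with parameters over (A, ∈); the
   predicate symbol is interpreted by the empty set.  The empty subset is
   listed separately because there is no assignment into A when A is empty. *)
Definition is_Def {U : membership_structure} (D A : U) : Prop :=
  exists E P, is_mem_relation E A /\ is_empty P /\
    forall y, y ∈ D <-> subset y A /\
      (is_empty y \/
       exists c s, is_formula c /\ assignment s A /\
         forall z, z ∈ A ->
           (z ∈ y <->
            exists i s', is_numeral 0 i /\ assignment s' A /\
              is_update s' s i z /\ models A E P c s')).

(* f(b) = L_b for b ∈ alpha, by the recursion L_b = union of the Def(L_g), g ∈ b. *)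
Definition is_L {U : membership_structure} (alpha X : U) : Prop :=
  exists f, fun_on f alpha /\
    (forall b Y, rel f b Y ->
       forall x, x ∈ Y <->
         exists g Z D, g ∈ b /\ rel f g Z /\ is_Def D Z /\ x ∈ D) /\
    (forall x, x ∈ X <->
       exists g Z D, rel f g Z /\ is_Def D Z /\ x ∈ D).

Definition V_equals_L (U : membership_structure) : Prop :=
  forall x : U, exists alpha X, ordinal alpha /\ is_L alpha X /\ x ∈ X.

(** * End elementary extensions, unfoldable and subtle cardinals *)

Definition elementary_extension {U : membership_structure}
    (M E S N F S' : U) : Prop :=
  subset M N /\
  forall c s, is_formula c -> assignment s M ->
    (models M E S c s <-> models N F S' c s).

Definition end_elementary_extension {U : membership_structure}
    (M E S N F S' : U) : Prop :=
  elementary_extension M E S N F S' /\ M <> N /\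
  forall a, a ∈ M ->
    forall b, (b ∈ M /\ rel E b a) <-> (b ∈ N /\ rel F b a).

Definition wellfounded {U : membership_structure} (N F : U) : Prop :=
  forall X, subset X N -> (exists x, x ∈ X) ->
    exists x, x ∈ X /\ forall y, y ∈ X -> ~ rel F y x.

Definition is_collapse {U : membership_structure} (pi N F : U) : Prop :=
  fun_on pi N /\
  forall x y, rel pi x y ->
    forall z, z ∈ y <-> exists x', rel F x' x /\ rel pi x' z.

(* o(N) is the set of ordinals of the transitive collapse of (N, F). *)
Definition is_ordinal_height {U : membership_structure} (N F h : U) : Prop :=
  exists pi, is_collapse pi N F /\
    forall b, b ∈ h <-> ordinal b /\ exists x, rel pi x b.

Definition unfoldable {U : membership_structure} (k : U) : Prop :=
  inaccessible k /\
  exists R E, is_R k R /\ is_mem_relation E R /\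
    forall alpha S, ordinal alpha -> subset S R ->
      exists N F S' h,
        is_structure N F S' /\
        end_elementary_extension R E S N F S' /\
        wellfounded N F /\
        is_ordinal_height N F h /\ subset alpha h.

Definition unbounded_in {U : membership_structure} (C l : U) : Prop :=
  forall x, x ∈ l -> exists c, c ∈ C /\ c ∈ l /\ x ∈ c.

Definition club {U : membership_structure} (C t : U) : Prop :=
  subset C t /\ unbounded_in C t /\
  forall l, l ∈ t -> ~ is_empty l -> unbounded_in C l -> l ∈ C.

Definition subtle {U : membership_structure} (t : U) : Prop :=
  inaccessible t /\
  forall S C,
    fun_on S t -> (forall a Sa, rel S a Sa -> subset Sa a) ->
    club C t ->
    exists b g Sb Sg,
      b ∈ C /\ g ∈ C /\ b ∈ g /\ rel S b Sb /\ rel S g Sg /\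
      forall x, (x ∈ Sg /\ x ∈ b) <-> x ∈ Sb.

Definition is_first {U : membership_structure} (Q : U -> Prop) (k : U) : Prop :=
  Q k /\ forall l, l ∈ k -> ~ Q l.

(* Main.v *)
From Stdlib Require Import Classical IndefiniteDescription Arith Lia.
Require Import Defs.
Set Implicit Arguments.
Unset Strict Implicit.

(** The existence of a subtle cardinal reflects below every unfoldable
    cardinal [k]; the first subtle cardinal is then below [k].

    Let [t] be subtle.  Unfoldability gives a well-founded end elementary
    extension [N] of [R(k)] whose ordinal height exceeds [t].  Let [j] be its
    Mostowski collapse and [x] the element of [N] with [j x = t].  Subtlety
    passes down to any transitive model containing [t]: its clauses speak of all
    functions and all clubs on [t], and a smaller universe has fewer of them
    ([locally_subtle_down]).  The one clause that does not have this shape is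
    strong limitness, which asks for an injection of the power set of [l] into
    some [m] below [t].  In the presence of choice it is equivalent to the absence
    of an injection of [t] into the power set of [l], a clause which does pass
    down.  The predicate [locally_subtle] is subtlety with this replacement, and
    with [omega ∈ t] expressed by bounded quantifiers; the equivalence is
    [subtle_locally_subtle] and [locally_subtle_subtle], and the use of choice
    is in [ordinal_set_comparable].

    Hence [N] satisfies that some ordinal is locally subtle, and by
    elementarity so does [R(k)].  As [R(k)] contains every subset of each of its
    ordinals and every function from such an ordinal to subsets of it, its witness
    is locally subtle in the universe ([locally_subtle_up]).

    The elementarity in the hypothesis concerns formulas coded inside the
    model and is mediated by satisfaction relations, which must be shown to
    exist ([satisfaction_exists]), and an external formula must be given an
    internal code ([formula_code_exists]).  Both are combined in
    [elementary_sentence]. *)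

(** * First-order definability *)

(** The formula does not depend on the structure, so that the same definition
    can be compared in [R(k)] and in its extension. *)
Definition first_order (P : forall U : membership_structure, (nat -> U) -> Prop) : Prop :=
  exists phi, forall (U : membership_structure) (e : nat -> U), holds e phi <-> P U e.

Lemma fo_mem i j : first_order (fun U e => e i ∈ e j).
Proof. exists (FMem i j). reflexivity. Qed.

Lemma fo_eq i j : first_order (fun U e => e i = e j).
Proof. exists (FEq i j). reflexivity. Qed.

Lemma fo_false : first_order (fun U e => False).
Proof. exists FFalse. reflexivity. Qed.

Lemma fo_imp {P Q : forall U : membership_structure, (nat -> U) -> Prop} :
  first_order P -> first_order Q ->
  first_order (fun U e => P U e -> Q U e).
Proof.
  intros [p hp] [q hq]. exists (FImp p q). intros U e. cbn.
  rewrite hp, hq. reflexivity.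
Qed.

Lemma fo_not {P : forall U : membership_structure, (nat -> U) -> Prop} :
  first_order P -> first_order (fun U e => ~ P U e).
Proof.
  intros [p hp]. exists (FImp p FFalse). intros U e. cbn. rewrite hp. reflexivity.
Qed.

Lemma fo_and {P Q : forall U : membership_structure, (nat -> U) -> Prop} :
  first_order P -> first_order Q ->
  first_order (fun U e => P U e /\ Q U e).
Proof.
  intros [p hp] [q hq]. exists (FImp (FImp p (FImp q FFalse)) FFalse).
  intros U e. cbn. rewrite hp, hq. tauto.
Qed.

Lemma fo_or {P Q : forall U : membership_structure, (nat -> U) -> Prop} :
  first_order P -> first_order Q ->
  first_order (fun U e => P U e \/ Q U e).
Proof.
  intros [p hp] [q hq]. exists (FImp (FImp p FFalse) q).
  intros U e. cbn. rewrite hp, hq. tauto.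
Qed.

Lemma fo_iff {P Q : forall U : membership_structure, (nat -> U) -> Prop} :
  first_order P -> first_order Q ->
  first_order (fun U e => P U e <-> Q U e).
Proof.
  intros [p hp] [q hq].
  exists (FImp (FImp (FImp p q) (FImp (FImp q p) FFalse)) FFalse).
  intros U e. cbn. rewrite hp, hq. tauto.
Qed.

Lemma fo_all {P : forall U : membership_structure, (nat -> U) -> U -> Prop} :
  first_order (fun U e => P U (fun n => e (S n)) (e 0)) ->
  first_order (fun U e => forall a : U, P U e a).
Proof.
  intros [p hp]. exists (FAll p). intros U e. cbn.
  split; intros h a; specialize (h a).
  - apply hp in h. exact h.
  - apply hp. exact h.
Qed.

Lemma fo_ex {P : forall U : membership_structure, (nat -> U) -> U -> Prop} :
  first_order (fun U e => P U (fun n => e (S n)) (e 0)) ->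
  first_order (fun U e => exists a : U, P U e a).
Proof.
  intros [p hp]. exists (FImp (FAll (FImp p FFalse)) FFalse). intros U e. cbn.
  split.
  - intro h. apply NNPP. intro n. apply h. intros a ha. apply n. exists a.
    apply hp in ha. exact ha.
  - intros [a ha] h. apply (h a). apply hp. exact ha.
Qed.

Create HintDb fo.
#[export] Hint Unfold is_empty subset is_succ inductive is_upair is_pair
  rel fun_on is_fun injective is_powerset transitive ordinal is_nat is_omega
  cardinal regular strong_limit inaccessible has_rank is_R is_code
  formula_closed is_formula assignment is_update is_satisfaction models
  is_structure is_mem_relation elementary_extension end_elementary_extension
  wellfounded is_collapse is_ordinal_height unfoldable unbounded_in club
  subtle : fo.

Ltac fo_step :=
  lazymatch goal with
  | |- first_order (fun U e => False) => apply fo_false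
  | |- first_order (fun U e => _ /\ _) => apply fo_and
  | |- first_order (fun U e => _ \/ _) => apply fo_or
  | |- first_order (fun U e => _ <-> _) => apply fo_iff
  | |- first_order (fun U e => ~ _) => apply fo_not
  | |- first_order (fun U e => exists a : carrier U, _) => apply fo_ex
  | |- first_order (fun U e => forall a : carrier U, _) => apply fo_all
  | |- first_order (fun U e => _ -> _) => apply fo_imp
  | |- first_order (fun U e => mem _ _) => apply fo_mem
  | |- first_order (fun U e => @eq (carrier U) _ _) => apply fo_eq
  | |- _ => progress (autounfold with fo; cbn [is_numeral])
  end.
Ltac fo := cbv beta iota; repeat fo_step.

Lemma separation {U} (hZ : ZFC U) (P : forall U : membership_structure, (nat -> U) -> Prop) :
  first_order P -> forall (e : nat -> U) (x : U),
  exists y, forall z, z ∈ y <-> z ∈ x /\ P U (scons z e).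
Proof.
  intros [p hp] e x. destruct (ax_separation hZ p e x) as [y hy].
  exists y. intro z. rewrite hy, hp. reflexivity.
Qed.

(** Separation applies to predicates of an environment, while the predicates met in
    proofs have free set variables.  These are moved one by one into an
    environment [e], the last one found at index 0. *)
Ltac abstract_params U F e k :=
  match F with
  | context [?a] =>
    is_var a;
    lazymatch type of a with carrier U => idtac end;
    lazymatch eval pattern a in F with
    | ?G _ =>
      let F' := eval cbv beta in
        (fun (e0 : nat -> carrier U) => G (e0 0) (fun n => e0 (S n))) in
      abstract_params U F' (@scons (carrier U) a e) k
    end
  | _ =>
    let F' := eval cbv beta in
      (fun (e0 : nat -> carrier U) => F (fun n => e0 (S n)) (e0 0)) in
    lazymatch eval pattern U in F' with
    | ?P _ => k P e
    end
  end.

Ltac by_separation :=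
  lazymatch goal with
  | hZ : ZFC ?U |- exists y, forall z, z ∈ y <-> z ∈ ?x /\ @?Q z =>
    abstract_params U (fun (_ : nat -> carrier U) => Q) (fun _ : nat => x)
      ltac:(fun P e => refine (separation hZ (P := P) _ e x); fo)
  end.

Tactic Notation "separate" ident(y) "from" constr(x) "by" uconstr(Q) "as" ident(h) :=
  let U := lazymatch type of x with carrier ?U => U end in
  let Q := constr:((fun q : carrier U -> Prop => q) Q) in
  let S := eval cbv beta in
    (exists y : carrier U, forall z : carrier U, z ∈ y <-> z ∈ x /\ Q z) in
  assert (h : S); [by_separation | destruct h as [y h]].

(** * Elementary set theory inside a model of ZFC *)

Section Basics.
Context {U : membership_structure} (hZ : ZFC U).

Lemma set_ext (x y : U) : (forall z, z ∈ x <-> z ∈ y) -> x = y.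
Proof. apply (ax_extensionality hZ). Qed.

Lemma mem_irrefl (x : U) : ~ x ∈ x.
Proof.
  intro h. destruct (ax_pairing hZ x x) as [p hp].
  destruct (ax_foundation hZ (x := p)) as [y [hy hm]].
  - exists x. apply hp. now left.
  - assert (y = x) by (apply hp in hy; tauto). subst y.
    apply (hm x h). exact hy.
Qed.

Lemma mem_asym (x y : U) : x ∈ y -> ~ y ∈ x.
Proof.
  intros h k. destruct (ax_pairing hZ x y) as [p hp].
  destruct (ax_foundation hZ (x := p)) as [z [hz hm]].
  - exists x. apply hp. now left.
  - apply hp in hz as hz'. destruct hz' as [-> | ->].
    + apply (hm y k). apply hp. now right.
    + apply (hm x h). apply hp. now left.
Qed.

Lemma empty_exists : exists o : U, is_empty o.
Proof.
  destruct (ax_infinity hZ) as [I _].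
  separate o from I by (fun z : U => ~ z = z) as h.
  exists o. intros z hz. apply h in hz. now apply hz.
Qed.

Lemma upair_exists (a b : U) : exists p, is_upair p a b.
Proof. apply (ax_pairing hZ). Qed.

Lemma upair_unique (p q a b : U) : is_upair p a b -> is_upair q a b -> p = q.
Proof. intros h k. apply set_ext. intro z. rewrite (h z), (k z). reflexivity. Qed.

Lemma pair_exists (a b : U) : exists p, is_pair p a b.
Proof.
  destruct (upair_exists a a) as [u hu], (upair_exists a b) as [v hv],
    (upair_exists u v) as [p hp].
  exists p, u, v. auto.
Qed.

Lemma pair_unique (p q a b : U) : is_pair p a b -> is_pair q a b -> p = q.
Proof.
  intros (u & v & hu & hv & hp) (u' & v' & hu' & hv' & hq).
  rewrite (upair_unique hu' hu), (upair_unique hv' hv) in hq.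
  exact (upair_unique hp hq).
Qed.

Lemma upair_inj (p a b c : U) : is_upair p a b -> is_upair p a c -> b = c.
Proof.
  intros h k.
  assert (hb : b = a \/ b = c) by (apply k, h; now right).
  assert (hc : c = a \/ c = b) by (apply h, k; now right).
  destruct hb, hc; congruence.
Qed.

Lemma pair_inj (p a b c d : U) : is_pair p a b -> is_pair p c d -> a = c /\ b = d.
Proof.
  intros (u & v & hu & hv & hp) (u' & v' & hu' & hv' & hq).
  assert (hac : a = c).
  { assert (ha : u = u' \/ u = v') by (apply hq, hp; now left).
    destruct ha as [<- | <-].
    - assert (c = a \/ c = a) by (apply hu, hu'; now left). intuition congruence.
    - assert (c = a \/ c = a) by (apply hu, hv'; now left). intuition congruence. }
  subst c. split; [reflexivity |].
  rewrite (upair_unique hu' hu) in hq.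
  rewrite (upair_inj hp hq) in hv. exact (upair_inj hv hv').
Qed.

Lemma rel_pair (r p a b : U) : is_pair p a b -> (rel r a b <-> p ∈ r).
Proof.
  intro h. split.
  - intros [q [hq k]]. now rewrite (pair_unique h hq).
  - intro k. now exists p.
Qed.

Lemma binary_union_exists (a b : U) : exists u, forall z, z ∈ u <-> z ∈ a \/ z ∈ b.
Proof.
  destruct (upair_exists a b) as [p hp], (ax_union hZ p) as [u hu].
  exists u. intro z. rewrite hu. split.
  - intros [y [hy hz]]. apply hp in hy. destruct hy; subst; auto.
  - intros [h | h]; [exists a | exists b]; split; auto; apply hp; auto.
Qed.

Lemma succ_exists (a : U) : exists s, is_succ s a.
Proof.
  destruct (upair_exists a a) as [p hp], (binary_union_exists a p) as [s hs].
  exists s. intro z. rewrite (hs z), (hp z). tauto.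
Qed.

Lemma succ_unique (s s' a : U) : is_succ s a -> is_succ s' a -> s = s'.
Proof. intros h k. apply set_ext. intro z. rewrite (h z), (k z). reflexivity. Qed.

Lemma empty_unique (a b : U) : is_empty a -> is_empty b -> a = b.
Proof. intros h k. apply set_ext. intro z. split; intro c; [case (h z c) | case (k z c)]. Qed.

Lemma succ_inj (s a b : U) : is_succ s a -> is_succ s b -> a = b.
Proof.
  intros h k.
  assert (ha : a ∈ b \/ a = b) by (apply k, h; now right).
  assert (hb : b ∈ a \/ b = a) by (apply h, k; now right).
  destruct ha as [ha | ha]; [| exact ha].
  destruct hb as [hb | hb]; [| now symmetry].
  case (mem_asym ha hb).
Qed.

Lemma powerset_exists (a : U) : exists p, is_powerset p a.
Proof. apply (ax_powerset hZ). Qed.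

Lemma product_exists (A B : U) :
  exists P, forall p, p ∈ P <-> exists a b, a ∈ A /\ b ∈ B /\ is_pair p a b.
Proof.
  destruct (binary_union_exists A B) as [C hC], (powerset_exists C) as [D hD],
    (powerset_exists D) as [E hE].
  separate P from E by (fun p => exists a b, a ∈ A /\ b ∈ B /\ is_pair p a b) as hP.
  exists P. intro p. rewrite hP. split; [tauto |]. intro h. split; [| exact h].
  destruct h as (a & b & ha & hb & u & v & hu & hv & hp).
  apply hE. intros w hw. apply hD. intros z hz. apply hC.
  apply hp in hw. destruct hw; subst w.
  - apply hu in hz. destruct hz; subst; auto.
  - apply hv in hz. destruct hz; subst; auto.
Qed.

Lemma relation_of_set (A B P r : U) (Q : U -> U -> Prop) :
  (forall p, p ∈ P <-> exists a b, a ∈ A /\ b ∈ B /\ is_pair p a b) ->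
  (forall p, p ∈ r <-> p ∈ P /\ exists a b, is_pair p a b /\ Q a b) ->
  exists r : U, (forall p, p ∈ r -> exists a b, a ∈ A /\ b ∈ B /\ is_pair p a b) /\
    forall a b, rel r a b <-> a ∈ A /\ b ∈ B /\ Q a b.
Proof.
  intros hP hr. exists r. split.
  - intros p hp. apply hP. apply hr in hp. tauto.
  - intros a b. destruct (pair_exists a b) as [p hp].
    rewrite (rel_pair r hp), hr, hP. split.
    + intros [(a1 & b1 & h1 & h2 & h3) (a2 & b2 & h4 & h5)].
      destruct (pair_inj hp h3), (pair_inj hp h4); subst. auto.
    + intros (ha & hb & hq). split; exists a, b; auto.
Qed.

End Basics.

Tactic Notation "separate_relation" ident(r) "from" constr(A) "to" constr(B)
    "by" uconstr(Q) "as" ident(h) ident(h') :=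
  let U := lazymatch type of A with carrier ?U => U end in
  let Q := constr:((fun q : carrier U -> carrier U -> Prop => q) Q) in
  let hZ := lazymatch goal with hZ : ZFC U |- _ => hZ end in
  let S := eval cbv beta in
    (exists r : carrier U,
       (forall p, p ∈ r -> exists a b, a ∈ A /\ b ∈ B /\ is_pair p a b) /\
       (forall a b, rel r a b <-> a ∈ A /\ b ∈ B /\ Q a b)) in
  let H := fresh in
  assert (H : S);
  [ let P := fresh "P" in let hP := fresh in
    destruct (product_exists hZ A B) as [P hP];
    let G := eval cbv beta in (fun p : carrier U => exists a b : carrier U, is_pair p a b /\ Q a b) in
    let r0 := fresh "r" in let h0 := fresh in
    separate r0 from P by G as h0;
    exact (relation_of_set hZ (Q := Q) hP h0)
  | destruct H as [r [h h']]].

(** * Ordinals, natural numbers, functions *)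

Section Ordinals.
Context {U : membership_structure} (hZ : ZFC U).

Lemma ordinal_elt (a b : U) : ordinal a -> b ∈ a -> ordinal b.
Proof.
  intros [h1 h2] hb. split; [now apply h2 |].
  intros y hy. apply h2. now apply (h1 b hb).
Qed.

Lemma minimal_element (x a : U) : a ∈ x -> exists y, y ∈ x /\ forall z, z ∈ y -> ~ z ∈ x.
Proof. intro h. apply (ax_foundation hZ). now exists a. Qed.

(** If some pair is incomparable, take [x] minimal among the sets incomparable
    to a member of [b + 1], and then [y] minimal in [b + 1] incomparable to [x].
    Minimality makes [x] and [y] have the same elements. *)
Lemma ordinal_trichotomy (a b : U) :
  ordinal a -> ordinal b -> a ∈ b \/ a = b \/ b ∈ a.
Proof.
  intros ha hb. apply NNPP. intro hn.
  destruct (succ_exists hZ a) as [a' ha'], (succ_exists hZ b) as [b' hb'].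
  separate X from a' by
    (fun x => exists y, y ∈ b' /\ ~ (x ∈ y \/ x = y \/ y ∈ x)) as hX.
  assert (haX : a ∈ X).
  { apply hX. split; [apply ha'; auto |]. exists b. split; [apply hb'; auto | exact hn]. }
  destruct (minimal_element haX) as [x [hx hxm]].
  apply hX in hx as [hxa [y0 [hy0 hxy0]]].
  separate Y from b' by (fun y => ~ (x ∈ y \/ x = y \/ y ∈ x)) as hY.
  assert (hyY : y0 ∈ Y) by (apply hY; auto).
  destruct (minimal_element hyY) as [y [hy hym]].
  apply hY in hy as [hyb hxy].
  apply hxy. right. left. apply (set_ext hZ). intro z. split; intro hz.
  - assert (hza : z ∈ a').
    { apply ha'. apply ha' in hxa. left. destruct hxa as [hxa | ->]; [| exact hz].
      now apply (proj1 ha x hxa). }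
    assert (hzy : z ∈ y \/ z = y \/ y ∈ z).
    { apply NNPP. intro k. apply (hxm z hz). apply hX. split; [exact hza | now exists y]. }
    destruct hzy as [h | [-> | h]]; [exact h | exfalso; tauto |].
    assert (hxo : ordinal x).
    { apply ha' in hxa as [hxa | ->]; [exact (ordinal_elt ha hxa) | exact ha]. }
    case hxy. right. right. exact (proj1 hxo z hz y h).
  - assert (hyo : ordinal y).
    { apply hb' in hyb as [hyb | ->]; [exact (ordinal_elt hb hyb) | exact hb]. }
    assert (hzb : z ∈ b').
    { apply hb'. apply hb' in hyb. left. destruct hyb as [hyb | ->]; [| exact hz].
      now apply (proj1 hb y hyb). }
    assert (hxz : x ∈ z \/ x = z \/ z ∈ x).
    { apply NNPP. intro k. apply (hym z hz). apply hY. auto. }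
    destruct hxz as [h | [-> | h]]; [| exfalso; tauto | exact h].
    case hxy. left. exact (proj1 hyo z hz x h).
Qed.

Lemma ordinal_subset (a b : U) :
  ordinal a -> ordinal b -> subset a b -> a = b \/ a ∈ b.
Proof.
  intros ha hb hab. destruct (ordinal_trichotomy ha hb) as [h | [h | h]]; auto.
  case (mem_irrefl hZ (hab b h)).
Qed.

Lemma ordinal_succ (a s : U) : ordinal a -> is_succ s a -> ordinal s.
Proof.
  intros ha hs. split.
  - intros y hy z hz. apply hs. left. apply hs in hy as [hy | ->]; [| exact hz].
    exact (proj1 ha y hy z hz).
  - intros y hy. apply hs in hy as [hy | ->]; [exact (proj2 ha y hy) | exact (proj1 ha)].
Qed.

Lemma ordinal_empty (o : U) : is_empty o -> ordinal o.
Proof. intro h. split; intros y hy; case (h y hy). Qed.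

Lemma nat_zero (o : U) : is_empty o -> is_nat o.
Proof. intros h I hI. now apply hI. Qed.

Lemma nat_succ (n s : U) : is_nat n -> is_succ s n -> is_nat s.
Proof. intros h hs I hI. apply (proj2 hI n); auto. Qed.

Lemma omega_exists : exists w : U, is_omega w.
Proof.
  destruct (ax_infinity hZ) as [I hI].
  separate w from I by (fun z => is_nat z) as hw.
  exists w. intro n. rewrite hw. split; [tauto |]. intro h. auto.
Qed.

Lemma omega_unique (w w' : U) : is_omega w -> is_omega w' -> w = w'.
Proof. intros h k. apply (set_ext hZ). intro n. rewrite (h n), (k n). reflexivity. Qed.

(** Induction on natural numbers is available for sets only, so the property
    is first collected into a subset of an inductive set. *)
Lemma nat_ordinal (n : U) : is_nat n -> ordinal n.
Proof.
  destruct (ax_infinity hZ) as [I hI].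
  separate w from I by (fun z => ordinal z) as hw.
  intro hn. enough (hnw : n ∈ w) by now apply hw in hnw.
  apply hn. split.
  - intros z hz. apply hw. split; [now apply hI | now apply ordinal_empty].
  - intros x y hx hy. apply hw in hx as [hx hox]. apply hw.
    split; [now apply (proj2 hI x) | exact (ordinal_succ hox hy)].
Qed.

Lemma nat_elt (n m : U) : is_nat n -> m ∈ n -> is_nat m.
Proof.
  destruct (ax_infinity hZ) as [I hI].
  separate w from I by (fun z => forall m, m ∈ z -> is_nat m) as hw.
  separate v from w by (fun z => is_nat z) as hv.
  intro hn. enough (hnv : n ∈ v) by (apply hv in hnv as [hnw _]; apply hw in hnw as [_ h]; exact (h m)).
  apply hn. split.
  - intros z hz. apply hv. split; [| now apply nat_zero].
    apply hw. split; [now apply hI |]. intros m' hm. case (hz m' hm).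
  - intros x y hx hy. apply hv in hx as [hx hnx]. apply hw in hx as [hx hox].
    apply hv. split; [| exact (nat_succ hnx hy)]. apply hw.
    split; [now apply (proj2 hI x) |].
    intros m' hm. apply hy in hm as [hm | ->]; auto.
Qed.

Lemma omega_ordinal (w : U) : is_omega w -> ordinal w.
Proof.
  intro hw. split.
  - intros y hy z hz. apply hw. apply hw in hy. exact (nat_elt hy hz).
  - intros y hy. apply hw in hy. exact (proj1 (nat_ordinal hy)).
Qed.

Lemma numeral_nat n (x : U) : is_numeral n x -> is_nat x.
Proof.
  revert x. induction n as [| n IH]; intros x h.
  - now apply nat_zero.
  - destruct h as [y [hy hs]]. exact (nat_succ (IH y hy) hs).
Qed.

Lemma numeral_exists n : exists x : U, is_numeral n x.
Proof.
  induction n as [| n [x hx]]; [apply (empty_exists hZ) |].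
  destruct (succ_exists hZ x) as [s hs]. exists s, x. auto.
Qed.

Lemma numeral_unique n (x y : U) : is_numeral n x -> is_numeral n y -> x = y.
Proof.
  revert x y. induction n as [| n IH]; intros x y.
  - apply (empty_unique hZ).
  - intros [x' [hx hs]] [y' [hy hs']]. rewrite (IH y' x' hy hx) in hs'.
    exact (succ_unique hZ hs hs').
Qed.

Lemma numeral_inj n m (x : U) : is_numeral n x -> is_numeral m x -> n = m.
Proof.
  revert m x. induction n as [| n IH]; intros [| m] x; cbn.
  - reflexivity.
  - intros h [y [_ hs]]. case (h y). apply hs. now right.
  - intros [y [_ hs]] h. case (h y). apply hs. now right.
  - intros [y [hy hs]] [y' [hy' hs']]. rewrite (succ_inj hZ hs' hs) in hy'.
    now rewrite (IH m y hy hy').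
Qed.

Lemma fun_on_of_rel (r A B : U) :
  (forall p, p ∈ r -> exists a b, a ∈ A /\ b ∈ B /\ is_pair p a b) ->
  (forall a, a ∈ A -> exists b, rel r a b) ->
  (forall a b b', rel r a b -> rel r a b' -> b = b') -> fun_on r A.
Proof.
  intros h1 h2 h3. split; [| auto].
  intros p hp. destruct (h1 p hp) as (a & b & ha & _ & hab). eauto.
Qed.

Lemma fun_on_dom (f A a b : U) : fun_on f A -> rel f a b -> a ∈ A.
Proof.
  intros [h _] [p [hp k]]. destruct (h p k) as (a' & b' & ha & hp').
  now destruct (pair_inj hZ hp hp') as [-> _].
Qed.

End Ordinals.

(** * Comparing a set with an ordinal *)

(** [c] serves as a choice function on subsets: it is a set of pairs that
    contains, for each relevant nonempty [B], one pair [(B, b)] with [b ∈ B]. *)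
Definition chosen {U : membership_structure} (c B y : U) : Prop :=
  y ∈ B /\ rel c B y.

Definition greedy_value {U : membership_structure} (c A f b y : U) : Prop :=
  exists B, (forall z, z ∈ B <-> z ∈ A /\ ~ exists b', b' ∈ b /\ rel f b' z) /\
    chosen c B y.

(** [f] enumerates elements of [A] along [a] without repetition, each value
    being the one that [c] picks from what is left of [A]. *)
Definition greedy {U : membership_structure} (c A f a : U) : Prop :=
  fun_on f a /\ forall b y, rel f b y -> greedy_value c A f b y.

#[export] Hint Unfold chosen greedy_value greedy : fo.

Section Comparability.
Context {U : membership_structure} (hZ : ZFC U).

(** The axiom of choice speaks of disjoint families; the sets [{B} × B] form one. *)
Lemma choice_relation (A : U) : exists c, forall B, subset B A -> (exists b, b ∈ B) ->
  exists b, chosen c B b /\ forall b', chosen c B b' -> b' = b.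
Proof.
  destruct (powerset_exists hZ A) as [PA hPA], (product_exists hZ PA A) as [Pr hPr],
    (powerset_exists hZ Pr) as [PP hPP].
  separate F from PP by (fun y => exists B, subset B A /\ (exists b, b ∈ B) /\
    forall p, p ∈ y <-> exists b, b ∈ B /\ is_pair p B b) as hF.
  destruct (ax_choice hZ (x := F)) as [c hc].
  - intros y hy. apply hF in hy as (_ & B & _ & [b hb] & h).
    destruct (pair_exists hZ B b) as [p hp]. exists p. apply h. eauto.
  - intros y y' z hy hy' hz hz'.
    apply hF in hy as (_ & B & _ & _ & h). apply hF in hy' as (_ & B' & _ & _ & h').
    apply h in hz as hz1. apply h' in hz' as hz2.
    destruct hz1 as (b & _ & hb), hz2 as (b' & _ & hb').
    destruct (pair_inj hZ hb hb') as [-> _].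
    apply (set_ext hZ). intro p. now rewrite h, h'.
  - exists c. intros B hB hne.
    separate y from Pr by (fun p => exists b, b ∈ B /\ is_pair p B b) as hy.
    assert (hy' : forall p, p ∈ y <-> exists b, b ∈ B /\ is_pair p B b).
    { intro p. rewrite hy. split; [tauto |]. intros (b & hb & hp).
      split; [| eauto]. apply hPr. exists B, b. split; [now apply hPA | auto]. }
    destruct (hc y) as (z & [hzc hzy] & hu).
    { apply hF. split.
      - apply hPP. intros p hp. now apply hy in hp.
      - exists B. auto. }
    apply hy' in hzy as (b & hb & hp). exists b. split.
    + split; [exact hb | now exists z].
    + intros b' [hb' [q [hq hqc]]].
      assert (q = z) by (apply hu; [exact hqc | apply hy'; eauto]). subst q.
      now apply (pair_inj hZ hq hp).
Qed.

Lemma chosen_unique (A c : U) :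
  (forall B, subset B A -> (exists b, b ∈ B) ->
    exists b, chosen c B b /\ forall b', chosen c B b' -> b' = b) ->
  forall B y y', subset B A -> chosen c B y -> chosen c B y' -> y = y'.
Proof.
  intros hc B y y' hB hy hy'. destruct (hc B hB) as (b & _ & hb).
  { exists y. apply hy. }
  now rewrite (hb y hy), (hb y' hy').
Qed.

(** The value at [b] is determined by the earlier ones; a minimal point of
    disagreement is impossible. *)
Lemma greedy_coherent (A c : U) :
  (forall B y y', subset B A -> chosen c B y -> chosen c B y' -> y = y') ->
  forall f f' a a', ordinal a -> ordinal a' -> greedy c A f a -> greedy c A f' a' ->
  forall b y y', b ∈ a' -> rel f b y -> rel f' b y' -> y = y'.
Proof.
  intros hc f f' a a' ha ha' [hf hgf] [hf' hgf'] b y y' hb' hy hy'.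
  assert (hb : b ∈ a) by exact (fun_on_dom hZ hf hy).
  separate D from a by
    (fun b => b ∈ a' /\ exists y y', rel f b y /\ rel f' b y' /\ ~ y = y') as hD.
  apply NNPP. intro hne.
  assert (hbD : b ∈ D) by (apply hD; eauto 10).
  clear y y' hy hy' hne hb hb'. destruct (minimal_element hZ hbD) as [d [hd hm]].
  apply hD in hd as (hda & hda' & y & y' & hy & hy' & hne). apply hne.
  destruct (hgf d y hy) as (B & hB & hyB). destruct (hgf' d y' hy') as (B' & hB' & hyB').
  assert (heq : forall e z, e ∈ d -> rel f e z <-> rel f' e z).
  { intros e z he.
    assert (hea : e ∈ a) by exact (proj1 ha d hda e he).
    assert (hea' : e ∈ a') by exact (proj1 ha' d hda' e he).
    destruct (proj1 (proj2 hf) e hea) as [u hu].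
    destruct (proj1 (proj2 hf') e hea') as [u' hu'].
    assert (u = u').
    { apply NNPP. intro k. apply (hm e he). apply hD. eauto 12. }
    subst u'. split; intro h.
    - now rewrite (proj2 (proj2 hf) e z u h hu).
    - now rewrite (proj2 (proj2 hf') e z u h hu'). }
  assert (B = B').
  { apply (set_ext hZ). intro z. rewrite hB, hB'. split; intros [h k]; split; auto;
    intros (e & he & hr); apply k; exists e; split; auto; now apply heq. }
  subst B'. apply (hc B); auto. intros z hz. now apply hB in hz.
Qed.

Lemma greedy_injective (A c f a : U) : ordinal a -> greedy c A f a -> injective f.
Proof.
  intros ha [hf hg] b b' y hb hb'.
  assert (hba : b ∈ a) by exact (fun_on_dom hZ hf hb).
  assert (hba' : b' ∈ a) by exact (fun_on_dom hZ hf hb').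
  destruct (ordinal_trichotomy hZ (ordinal_elt ha hba) (ordinal_elt ha hba'))
    as [h | [h | h]]; [exfalso | exact h | exfalso].
  - destruct (hg b' y hb') as (B & hB & [hy _]). apply hB in hy as [_ hy]. eauto.
  - destruct (hg b y hb) as (B & hB & [hy _]). apply hB in hy as [_ hy]. eauto.
Qed.

Lemma greedy_range (A c f a : U) : greedy c A f a -> forall b y, rel f b y -> y ∈ A.
Proof.
  intros [_ hg] b y h. destruct (hg b y h) as (B & hB & [hy _]). now apply hB in hy.
Qed.

(** If no greedy enumeration of length below [t] exhausts [A], each of them can be
    prolonged by one step, and by coherence their union enumerates along [t];
    an exhausting one is inverted.  This is the proof of the well-ordering
    theorem, stopped at [t]. *)
Lemma ordinal_set_comparable (t A : U) :
  ordinal t -> (forall a s, a ∈ t -> is_succ s a -> s ∈ t) ->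
  (exists f, is_fun f t A /\ injective f) \/
  (exists a g, a ∈ t /\ is_fun g A a /\ injective g).
Proof.
  intros ht hlim. destruct (choice_relation A) as [c hc0].
  pose proof (chosen_unique hc0) as hc.
  pose proof (greedy_coherent hc) as hcoh.
  destruct (classic (exists a f, a ∈ t /\ greedy c A f a /\
    forall z, z ∈ A -> exists b, rel f b z)) as [(a & f & ha & hf & hs) | hns].
  - right. exists a.
    assert (hoa : ordinal a) by exact (ordinal_elt ht ha).
    separate_relation g from A to a by (fun z b => rel f b z) as hg hg'.
    assert (hfg : forall z b, rel g z b <-> rel f b z).
    { intros z b. rewrite hg'. split; [tauto |]. intro h. repeat split; auto.
      - exact (greedy_range hf h).
      - exact (fun_on_dom hZ (proj1 hf) h). }
    exists g. split; [exact ha |]. split.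
    + split; [| intros z b h; now apply hg' in h].
      apply (fun_on_of_rel hg).
      * intros z hz. destruct (hs z hz) as [b hb]. exists b. now apply hfg.
      * intros z b b' h h'. apply hfg in h, h'.
        exact (greedy_injective hoa hf h h').
    + intros z z' b h h'. apply hfg in h, h'.
      exact (proj2 (proj2 (proj1 hf)) b z z' h h').
  - left.
    separate_relation G from t to A by (fun b y =>
      exists a f, a ∈ t /\ b ∈ a /\ greedy c A f a /\ rel f b y) as hG hG'.
    assert (hGf : forall b y, rel G b y <->
      exists a f, a ∈ t /\ b ∈ a /\ greedy c A f a /\ rel f b y).
    { intros b y. rewrite hG'. split; [tauto |]. intros (a & f & ha & hb & hf & h).
      repeat split; eauto 12.
      - exact (proj1 ht a ha b hb).
      - exact (greedy_range hf h). }
    assert (hfun : forall b y y', rel G b y -> rel G b y' -> y = y').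
    { intros b y y' h h'. apply hGf in h as (a & f & ha & hb & hf & h).
      apply hGf in h' as (a' & f' & ha' & hb' & hf' & h').
      exact (hcoh f f' a a' (ordinal_elt ht ha) (ordinal_elt ht ha') hf hf'
               b y y' hb' h h'). }
    assert (hval : forall b y, rel G b y -> greedy_value c A G b y).
    { intros b y h. apply hGf in h as (a & f & ha & hb & hf & h).
      destruct (proj2 hf b y h) as (B & hB & hy). exists B. split; [| exact hy].
      intro z. rewrite hB. split; intros [hz k]; split; auto; intros (e & he & hr);
        apply k; exists e; split; auto.
      - apply hGf in hr as hr'. destruct hr' as (a' & f' & ha' & hea' & hf' & hr').
        assert (hea : e ∈ a) by exact (proj1 (ordinal_elt ht ha) b hb e he).
        destruct (proj1 (proj2 (proj1 hf)) e hea) as [u hu].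
        assert (u = z); [| now subst u].
        apply (hfun e); [| exact hr]. apply hGf. eauto 12.
      - apply hGf. exists a, f. repeat split; auto; try apply hf.
        exact (proj1 (ordinal_elt ht ha) b hb e he). }
    (* At a least point outside the domain of G, the part of G below it is a greedy
       enumeration g that does not exhaust A, and its prolongation g' is one of the
       approximations that make up G. *)
    assert (hdom : forall b, b ∈ t -> exists y, rel G b y).
    { intros b0 hb0. apply NNPP. intro hn.
      separate D from t by (fun b => ~ exists y, rel G b y) as hD.
      assert (hbD : b0 ∈ D) by (apply hD; auto).
      destruct (minimal_element hZ hbD) as [b [hb hm]].
      apply hD in hb as [hbt hb]. clear b0 hb0 hn hbD.
      assert (hob : ordinal b) by exact (ordinal_elt ht hbt).
      assert (hdb : forall e, e ∈ b -> exists y, rel G e y).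
      { intros e he. apply NNPP. intro k. apply (hm e he). apply hD.
        split; [exact (proj1 ht b hbt e he) | exact k]. }
      separate_relation g from b to A by (fun e y => rel G e y) as hg hg'.
      assert (hgG : forall e y, e ∈ b -> rel g e y <-> rel G e y).
      { intros e y he. rewrite hg'. split; [tauto |]. intro h. repeat split; auto.
        apply hG' in h. tauto. }
      assert (hgr : greedy c A g b).
      { split.
        - apply (fun_on_of_rel hg).
          + intros e he. destruct (hdb e he) as [y hy]. exists y. now apply hgG.
          + intros e y y' h h'. apply hg' in h, h'. apply (hfun e); tauto.
        - intros e y h. apply hg' in h as (he & hy & h).
          destruct (hval e y h) as (B & hB & k). exists B. split; [| exact k].
          intro z. rewrite hB. split; intros [hz q]; split; auto; intros (e' & he' & hr);
            apply q; exists e'; split; auto; apply hgG; auto; exact (proj1 hob e he e' he'). }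
      separate B from A by (fun z => ~ exists e, e ∈ b /\ rel g e z) as hB.
      assert (hne : exists z, z ∈ B).
      { apply NNPP. intro k. apply hns. exists b, g. repeat split; auto; try apply hgr.
        intros z hz. apply NNPP. intro q. apply k. exists z. apply hB. split; [exact hz |].
        intros (e & _ & h). eauto. }
      assert (hBA : subset B A) by (intros z hz; now apply hB in hz).
      destruct (hc0 B hBA hne) as (y & hy & _).
      destruct (succ_exists hZ b) as [s hs].
      assert (hst : s ∈ t) by exact (hlim b s hbt hs).
      separate_relation g' from s to A by
        (fun e z => rel g e z \/ e = b /\ z = y) as hg1 hg1'.
      assert (hb1 : forall e z, e ∈ b -> rel g' e z <-> rel g e z).
      { intros e z he. rewrite hg1'. split.
        - intros (_ & _ & [h | [-> _]]); [exact h | case (mem_irrefl hZ he)].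
        - intro h. repeat split; auto; [apply hs; auto | exact (greedy_range hgr h)]. }
      assert (hyA : y ∈ A) by (apply hBA, hy).
      assert (hb2 : forall z, rel g' b z <-> z = y).
      { intro z. rewrite hg1'. split.
        - intros (_ & _ & [h | [_ h]]); [| exact h].
          case (mem_irrefl hZ (fun_on_dom hZ (proj1 hgr) h)).
        - intros ->. repeat split; auto. apply hs. auto. }
      assert (hgr' : greedy c A g' s).
      { split.
        - apply (fun_on_of_rel hg1).
          + intros e he. apply hs in he as [he | ->].
            * destruct (proj1 (proj2 (proj1 hgr)) e he) as [z hz]. exists z. now apply hb1.
            * exists y. now apply hb2.
          + intros e z z' h h'. assert (he : e ∈ s) by (apply hg1' in h; tauto).
            apply hs in he as [he | ->].
            * apply hb1 in h, h'; auto. exact (proj2 (proj2 (proj1 hgr)) e z z' h h').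
            * apply hb2 in h, h'. congruence.
        - intros e z h. assert (he : e ∈ s) by (apply hg1' in h; tauto).
          apply hs in he as [he | ->].
          + apply hb1 in h; auto. destruct (proj2 hgr e z h) as (B' & hB' & k).
            exists B'. split; [| exact k]. intro w. rewrite hB'.
            split; intros [hw q]; split; auto; intros (e' & he' & hr);
            apply q; exists e'; split; auto; apply hb1; auto; exact (proj1 hob e he e' he').
          + apply hb2 in h. subst z. exists B. split; [| exact hy].
            intro w. rewrite hB.
            split; intros [hw q]; split; auto; intros (e' & he' & hr);
            apply q; exists e'; split; auto; apply hb1; auto. }
      apply hb. exists y. apply hGf. exists s, g'. repeat split; auto; try apply hgr'.
      - apply hs. auto.
      - now apply hb2. }
    assert (hGg : greedy c A G t).
    { split; [| exact hval]. exact (fun_on_of_rel hG hdom hfun). }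
    exists G. split; [split |].
    + apply hGg.
    + intros b y h. apply hG' in h. tauto.
    + exact (greedy_injective ht hGg).
Qed.

End Comparability.

(** * Ranks *)

Section Ranks.
Context {U : membership_structure} (hZ : ZFC U).

Lemma rank_unique (x rho rho' : U) : has_rank x rho -> has_rank x rho' -> rho = rho'.
Proof.
  intros (t & r & ht & hx & hr & hxr & h) (t' & r' & ht' & hx' & hr' & hxr' & h').
  apply NNPP. intro hne.
  separate D from t by
    (fun y => y ∈ t' /\ exists s s', rel r y s /\ rel r' y s' /\ ~ s = s') as hD.
  assert (hxD : x ∈ D) by (apply hD; eauto 10).
  destruct (minimal_element hZ hxD) as [y [hy hm]].
  apply hD in hy as (hyt & hyt' & s & s' & hs & hs' & hss). apply hss.
  assert (key : forall z u, z ∈ y -> rel r z u <-> rel r' z u).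
  { intros z u hz.
    assert (hzt : z ∈ t) by exact (ht y hyt z hz).
    assert (hzt' : z ∈ t') by exact (ht' y hyt' z hz).
    destruct (proj1 (proj2 hr) z hzt) as [v hv].
    destruct (proj1 (proj2 hr') z hzt') as [v' hv'].
    assert (v = v').
    { apply NNPP. intro k. apply (hm z hz). apply hD. eauto 12. }
    subst v'. split; intro q.
    - now rewrite (proj2 (proj2 hr) z u v q hv).
    - now rewrite (proj2 (proj2 hr') z u v q hv'). }
  apply (set_ext hZ). intro d. rewrite (h y s hs), (h' y s' hs').
  split; intros (z & u & hz & hu & hd); exists z, u; repeat split; auto; now apply key.
Qed.

(** The auxiliary transitive set and function of [has_rank] can be
    forgotten. *)
Lemma rank_spec (x rho : U) : has_rank x rho ->
  (forall z, z ∈ x -> exists s, has_rank z s) /\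
  forall d, d ∈ rho <-> exists z s, z ∈ x /\ has_rank z s /\ (d ∈ s \/ d = s).
Proof.
  intros (t & r & ht & hx & hr & hxr & h).
  assert (hrk : forall z s, z ∈ t -> rel r z s -> has_rank z s).
  { intros z s hz hs. exists t, r. auto. }
  assert (hz : forall z, z ∈ x -> exists s, rel r z s /\ has_rank z s).
  { intros z hz. assert (hzt := ht x hx z hz).
    destruct (proj1 (proj2 hr) z hzt) as [s hs]. exists s. auto. }
  split.
  - intros z k. destruct (hz z k) as [s [_ hs]]. eauto.
  - intro d. rewrite (h x rho hxr d). split.
    + intros (z & s & h1 & h2 & h3). exists z, s. repeat split; auto.
      apply hrk; [exact (ht x hx z h1) | exact h2].
    + intros (z & s & h1 & h2 & h3). destruct (hz z h1) as [s' [h4 h5]].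
      rewrite (rank_unique h2 h5) in h3. exists z, s'. auto.
Qed.

Lemma rank_elt (x z rho : U) : has_rank x rho -> z ∈ x -> exists s, has_rank z s /\ s ∈ rho.
Proof.
  intros h hz. destruct (rank_spec h) as [h1 h2]. destruct (h1 z hz) as [s hs].
  exists s. split; [exact hs |]. apply h2. exists z, s. auto.
Qed.

Lemma ordinal_rank (a : U) : ordinal a -> has_rank a a.
Proof.
  intro ha. destruct (succ_exists hZ a) as [t ht].
  pose proof (ordinal_succ ha ht) as hot.
  separate_relation r from t to t by (fun y z => z = y) as hr hr'.
  assert (hat : a ∈ t) by (apply ht; auto).
  exists t, r. split; [exact (proj1 hot) | split; [exact hat | split; [| split]]].
  - apply (fun_on_of_rel hr).
    + intros y hy. exists y. apply hr'. auto.
    + intros y z z' h h'. apply hr' in h, h'. destruct h as (_ & _ & ->). now symmetry.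
  - apply hr'. auto.
  - intros y s h d. apply hr' in h as (hy & _ & ->). split.
    + intro hd. exists d, d. repeat split; auto. apply hr'.
      assert (d ∈ t) by exact (proj1 hot y hy d hd). auto.
    + intros (z & s & hz & h & hd). apply hr' in h as (_ & _ & ->).
      destruct hd as [hd | ->]; [| exact hz].
      exact (proj1 (ordinal_elt hot hy) z hz d hd).
Qed.

(** A constant function on 1 with value [b] is bounded by an element of [k]
    above [b]. *)
Lemma regular_limit (k : U) : ordinal k -> (exists w, is_omega w /\ w ∈ k) -> regular k ->
  forall b s, b ∈ k -> is_succ s b -> s ∈ k.
Proof.
  intros hk (w & hw & hwk) hreg b s hb hs.
  destruct (empty_exists hZ) as [o ho], (succ_exists hZ o) as [i hi].
  assert (hik : i ∈ k).
  { apply (proj1 hk w hwk). apply hw. exact (nat_succ (nat_zero ho) hi). }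
  separate_relation f from i to k by (fun x y => y = b) as hf hf'.
  destruct (hreg i f hik) as (c & hc & hcb).
  { split; [| intros x y h; now apply hf' in h].
    apply (fun_on_of_rel hf).
    - intros x hx. exists b. apply hf'. auto.
    - intros x y y' h h'. apply hf' in h, h'. destruct h as (_ & _ & ->). now symmetry. }
  assert (hbc : b ∈ c).
  { apply (hcb o). apply hf'. repeat split; auto. apply hi. auto. }
  pose proof (ordinal_elt hk hc) as hoc.
  assert (hos : ordinal s) by exact (ordinal_succ (ordinal_elt hk hb) hs).
  assert (hsub : subset s c).
  { intros z hz. apply hs in hz as [hz | ->]; [| exact hbc]. exact (proj1 hoc b hbc z hz). }
  destruct (ordinal_subset hZ hos hoc hsub) as [-> | h]; [exact hc |].
  exact (proj1 hk c hc s h).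
Qed.

End Ranks.

Definition below {U : membership_structure} (b x : U) : Prop :=
  exists rho, rho ∈ b /\ has_rank x rho.

Section Levels.
Context {U : membership_structure} (hZ : ZFC U) {k R : U}
  (hk : inaccessible k) (hR : is_R k R).

Lemma inaccessible_ordinal : ordinal k.
Proof. apply hk. Qed.

Lemma inaccessible_limit b s : b ∈ k -> is_succ s b -> s ∈ k.
Proof. apply (regular_limit hZ inaccessible_ordinal); apply hk. Qed.

Lemma level_transitive x y : x ∈ R -> y ∈ x -> y ∈ R.
Proof.
  intros hx hy. apply hR in hx as (rho & hrho & hx).
  destruct (rank_elt hZ hx hy) as (s & hs & hsr). apply hR. exists s.
  split; [exact (proj1 inaccessible_ordinal rho hrho s hsr) | exact hs].
Qed.

Lemma below_level b x : b ∈ k -> below b x -> x ∈ R.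
Proof.
  intros hb (rho & h & h'). apply hR. exists rho.
  split; [exact (proj1 inaccessible_ordinal b hb rho h) | exact h'].
Qed.

Lemma below_mono b c (x : U) : subset b c -> below b x -> below c x.
Proof. intros h (rho & h1 & h2). exists rho. auto. Qed.

Lemma ordinal_level a : a ∈ k -> a ∈ R.
Proof.
  intro h. apply hR. exists a. split; [exact h |].
  exact (ordinal_rank hZ (ordinal_elt inaccessible_ordinal h)).
Qed.

Lemma level_ordinal a : a ∈ R -> ordinal a -> a ∈ k.
Proof.
  intros h ha. apply hR in h as (rho & hrho & h).
  now rewrite (rank_unique hZ (ordinal_rank hZ ha) h).
Qed.

(** If the elements of [x] have rank below [b], then the rank of [x] exists
    because the ranks of all members of [R] form a set function, which
    extends to [x]. *)
Lemma below_succ b s x : b ∈ k -> is_succ s b -> (forall z, z ∈ x -> below b z) -> below s x.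
Proof.
  intros hb hs hx.
  pose proof inaccessible_ordinal as hok.
  pose proof (ordinal_elt hok hb) as hob.
  separate rho from k by
    (fun d => exists z u, z ∈ x /\ has_rank z u /\ (d ∈ u \/ d = u)) as hrho.
  assert (hrho' : forall d, d ∈ rho <->
    exists z u, z ∈ x /\ has_rank z u /\ (d ∈ u \/ d = u)).
  { intro d. rewrite hrho. split; [tauto |]. intro h. split; [| exact h].
    destruct h as (z & u & hz & hu & hd). destruct (hx z hz) as (v & hv & hv').
    rewrite (rank_unique hZ hu hv') in hd.
    apply (proj1 hok b hb). destruct hd as [hd | ->]; [| exact hv].
    exact (proj1 hob v hv d hd). }
  assert (hsub : subset rho b).
  { intros d hd. apply hrho' in hd as (z & u & hz & hu & hd).
    destruct (hx z hz) as (v & hv & hv'). rewrite (rank_unique hZ hu hv') in hd.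
    destruct hd as [hd | ->]; [| exact hv]. exact (proj1 hob v hv d hd). }
  assert (horho : ordinal rho).
  { split.
    - intros d hd e he. apply hrho' in hd as (z & u & hz & hu & hd). apply hrho'.
      exists z, u. repeat split; auto. left. destruct hd as [hd | ->]; [| exact he].
      destruct (hx z hz) as (v & hv & hv'). rewrite (rank_unique hZ hu hv') in hd |- *.
      exact (proj1 (ordinal_elt hob hv) d hd e he).
    - intros d hd. exact (proj1 (ordinal_elt hob (hsub d hd))). }
  exists rho. split.
  { apply hs. destruct (ordinal_subset hZ horho hob hsub); auto. }
  destruct (classic (x ∈ R)) as [hxR | hxR].
  (* If x is in R, it has a rank already, and only its value is to be identified. *)
  { apply hR in hxR as (sigma & hsig & hxs).
    replace rho with sigma; [exact hxs |].
    apply (set_ext hZ). intro d. rewrite hrho'. apply (proj2 (rank_spec hZ hxs)). }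
  destruct (upair_exists hZ x x) as [sx hsx].
  destruct (binary_union_exists hZ R sx) as [t ht].
  separate_relation r from t to k by
    (fun y u => y ∈ R /\ has_rank y u \/ y = x /\ u = rho) as hr hr'.
  assert (hrhok : rho ∈ k).
  { destruct (ordinal_subset hZ horho hob hsub) as [-> | h]; [exact hb |].
    exact (proj1 hok b hb rho h). }
  assert (hxt : x ∈ t) by (apply ht; right; apply hsx; auto).
  assert (hrx : forall u, rel r x u <-> u = rho).
  { intro u. rewrite hr'. split; [| intros ->; auto].
    intros (_ & _ & [[h _] | [_ h]]); [case (hxR h) | exact h]. }
  assert (hrR : forall y u, y ∈ R -> rel r y u <-> has_rank y u).
  { intros y u hy. rewrite hr'. split.
    - intros (_ & _ & [[_ h] | [-> _]]); [exact h | case (hxR hy)].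
    - intro h. split; [apply ht; auto |]. split; [| auto].
      apply hR in hy as (v & hv & hy). now rewrite (rank_unique hZ h hy). }
  assert (hxe : forall z, z ∈ x -> z ∈ R).
  { intros z hz. exact (below_level hb (hx z hz)). }
  exists t, r. split; [| split; [exact hxt | split; [| split]]].
  - intros y hy z hz. apply ht. left. apply ht in hy as [hy | hy].
    + exact (level_transitive hy hz).
    + assert (y = x) by (apply hsx in hy; tauto). subst y. auto.
  - apply (fun_on_of_rel hr).
    + intros y hy. apply ht in hy as [hy | hy].
      * apply hR in hy as hy'. destruct hy' as (u & _ & hu). exists u. now apply hrR.
      * assert (y = x) by (apply hsx in hy; tauto). subst y. exists rho. now apply hrx.
    + intros y u u' h h'. assert (hy : y ∈ t) by (apply hr' in h; tauto).
      apply ht in hy as [hy | hy].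
      * apply hrR in h, h'; auto. exact (rank_unique hZ h h').
      * assert (y = x) by (apply hsx in hy; tauto). subst y.
        apply hrx in h, h'. congruence.
  - now apply hrx.
  - intros y u h d. assert (hy : y ∈ t) by (apply hr' in h; tauto).
    apply ht in hy as [hy | hy].
    + apply hrR in h; auto. rewrite (proj2 (rank_spec hZ h) d).
      split; intros (z & v & hz & hv & hd); exists z, v; repeat split; auto;
      apply hrR; auto; exact (level_transitive hy hz).
    + assert (y = x) by (apply hsx in hy; tauto). subst y.
      apply hrx in h. subst u. rewrite hrho'.
      split; intros (z & v & hz & hv & hd); exists z, v; repeat split; auto;
      apply hrR; auto.
Qed.

Lemma level_common_bound a b : a ∈ R -> b ∈ R -> exists c, c ∈ k /\ below c a /\ below c b.
Proof.
  intros ha hb. apply hR in ha as (u & hu & ha). apply hR in hb as (v & hv & hb).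
  pose proof inaccessible_ordinal as hok.
  destruct (succ_exists hZ u) as [su hsu], (succ_exists hZ v) as [sv hsv].
  destruct (ordinal_trichotomy hZ (ordinal_elt hok hu) (ordinal_elt hok hv))
    as [h | [h | h]].
  - exists sv. split; [exact (inaccessible_limit hv hsv) |].
    split; [exists u | exists v]; split; auto; apply hsv; auto.
  - exists sv. split; [exact (inaccessible_limit hv hsv) |].
    split; [exists u | exists v]; split; auto; apply hsv; auto.
  - exists su. split; [exact (inaccessible_limit hu hsu) |].
    split; [exists u | exists v]; split; auto; apply hsu; auto.
Qed.

Lemma below_upair b s p x y : b ∈ k -> is_succ s b -> below b x -> below b y ->
  is_upair p x y -> below s p.
Proof.
  intros hb hs hx hy hp. apply (below_succ hb hs). intros z hz.
  apply hp in hz as [-> | ->]; assumption.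
Qed.

Lemma below_pair b : b ∈ k -> exists c, c ∈ k /\
  forall p x y, below b x -> below b y -> is_pair p x y -> below c p.
Proof.
  intro hb. destruct (succ_exists hZ b) as [s hs], (succ_exists hZ s) as [c hc].
  pose proof (inaccessible_limit hb hs) as hsk.
  exists c. split; [exact (inaccessible_limit hsk hc) |].
  intros p x y hx hy (u & v & hu & hv & hp).
  apply (below_upair hsk hc (x := u) (y := v)); auto.
  - exact (below_upair hb hs hx hx hu).
  - exact (below_upair hb hs hx hy hv).
Qed.

Lemma level_pair p a b : a ∈ R -> b ∈ R -> is_pair p a b -> p ∈ R.
Proof.
  intros ha hb hp. destruct (level_common_bound ha hb) as (c & hc & hca & hcb).
  destruct (below_pair hc) as (d & hd & h).
  exact (below_level hd (h p a b hca hcb hp)).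
Qed.

Lemma level_relation b r : b ∈ k ->
  (forall p, p ∈ r -> exists x y, below b x /\ below b y /\ is_pair p x y) -> r ∈ R.
Proof.
  intros hb hr. destruct (below_pair hb) as (c & hc & h).
  destruct (succ_exists hZ c) as [s hs].
  apply (below_level (inaccessible_limit hc hs)). apply (below_succ hc hs).
  intros p hp. destruct (hr p hp) as (x & y & hx & hy & hxy). eauto.
Qed.

Lemma level_subset b x : b ∈ k -> subset x b -> x ∈ R.
Proof.
  intros hb hx. destruct (succ_exists hZ b) as [s hs].
  apply (below_level (inaccessible_limit hb hs)). apply (below_succ hb hs).
  intros z hz. exists z. split; [auto |]. apply (ordinal_rank hZ).
  exact (ordinal_elt (ordinal_elt inaccessible_ordinal hb) (hx z hz)).
Qed.

Lemma level_nat n : is_nat n -> n ∈ R.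
Proof.
  intro hn. destruct (proj1 (proj2 hk)) as (w & hw & hwk).
  apply ordinal_level. apply (proj1 inaccessible_ordinal w hwk). now apply hw.
Qed.

Lemma level_code tag c a b : a ∈ R -> b ∈ R -> is_code tag c a b -> c ∈ R.
Proof.
  intros ha hb (n & p & hn & hp & hc).
  apply (level_pair (a := n) (b := p)); auto.
  - apply level_nat. exact (numeral_nat hn).
  - exact (level_pair ha hb hp).
Qed.

Lemma level_formula_closed : formula_closed R.
Proof.
  split; [| split; [| split; [| split]]].
  - intros i j c hi hj hc. exact (level_code (level_nat hi) (level_nat hj) hc).
  - intros i j c hi hj hc. exact (level_code (level_nat hi) (level_nat hj) hc).
  - intros i c hi hc. exact (level_code (level_nat hi) (level_nat hi) hc).
  - intros a b c ha hb hc. exact (level_code ha hb hc).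
  - intros i a c hi ha hc. exact (level_code (level_nat hi) ha hc).
Qed.

End Levels.

(** * Existence of satisfaction relations *)

(** One step of the simultaneous recursion that attaches to a formula [c] the set [C]
    of assignments satisfying it; [W] relates smaller formulas to their
    truth sets.  [W] occurs only positively, although the clause for [3]
    complements truth sets, so the recursion is a monotone inductive definition. *)
Definition truth_step {U : membership_structure} (M F P W c C : U) : Prop :=
  (forall s, s ∈ C -> assignment s M) /\
  ((exists i j, is_nat i /\ is_nat j /\ is_code 0 c i j /\
      forall s, assignment s M ->
        (s ∈ C <-> exists a b, rel s i a /\ rel s j b /\ rel F a b)) \/
   (exists i j, is_nat i /\ is_nat j /\ is_code 1 c i j /\
      forall s, assignment s M -> (s ∈ C <-> exists a, rel s i a /\ rel s j a)) \/
   (exists i, is_nat i /\ is_code 2 c i i /\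
      forall s, assignment s M -> (s ∈ C <-> exists a, rel s i a /\ a ∈ P)) \/
   (exists f g A B, rel W f A /\ rel W g B /\ is_code 3 c f g /\
      forall s, assignment s M -> (s ∈ C <-> ~ (s ∈ A /\ s ∈ B))) \/
   (exists i f A, is_nat i /\ rel W f A /\ is_code 4 c i f /\
      forall s, assignment s M ->
        (s ∈ C <-> exists a s', a ∈ M /\ assignment s' M /\
                     is_update s' s i a /\ s' ∈ A))).

(** The least relation closed under [truth_step]. *)
Definition truth_set {U : membership_structure} (M F P c C : U) : Prop :=
  forall W, (forall c C, truth_step M F P W c C -> rel W c C) -> rel W c C.

#[export] Hint Unfold truth_step truth_set : fo.

Section Satisfaction.
Context {U : membership_structure} (hZ : ZFC U).

Lemma code_exists tag (a b : U) : exists c, is_code tag c a b.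
Proof.
  destruct (numeral_exists hZ tag) as [n hn], (pair_exists hZ a b) as [p hp],
    (pair_exists hZ n p) as [c hc].
  exists c, n, p. auto.
Qed.

Lemma code_inj tag tag' (c a b a' b' : U) :
  is_code tag c a b -> is_code tag' c a' b' -> tag = tag' /\ a = a' /\ b = b'.
Proof.
  intros (n & p & hn & hp & hc) (n' & p' & hn' & hp' & hc').
  destruct (pair_inj hZ hc hc') as [<- <-]. destruct (pair_inj hZ hp hp') as [<- <-].
  split; [exact (numeral_inj hZ hn hn') | auto].
Qed.

Context {M F P X : U} (hX : formula_closed X).

Lemma truth_step_mono W W' c C : (forall f A, rel W f A -> rel W' f A) ->
  truth_step M F P W c C -> truth_step M F P W' c C.
Proof.
  intros h [hC k]. split; [exact hC |].
  destruct k as [k | [k | [k | [k | k]]]]; [auto | auto | auto | |].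
  - destruct k as (f & g & A & B & h1 & h2 & h3). right; right; right; left.
    exists f, g, A, B. auto.
  - destruct k as (i & f & A & h1 & h2 & h3). right; right; right; right.
    exists i, f, A. auto.
Qed.

Lemma truth_set_intro W c C : (forall f A, rel W f A -> truth_set M F P f A) ->
  truth_step M F P W c C -> truth_set M F P c C.
Proof.
  intros hW h V hV. apply hV. apply (truth_step_mono (W := W)); [| exact h].
  intros f A hf. exact (hW f A hf V hV).
Qed.

Lemma assignment_set : exists Ass, forall s, s ∈ Ass <-> assignment s M.
Proof.
  destruct (omega_exists hZ) as [w hw], (product_exists hZ w M) as [D hD],
    (powerset_exists hZ D) as [E hE].
  separate Ass from E by (fun s => assignment s M) as hA.
  exists Ass. intro s. rewrite hA. split; [tauto |]. intro h. split; [| exact h].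
  destruct h as (w' & hw' & hs & hsM). rewrite (omega_unique hZ hw' hw) in hs.
  apply hE. intros p hp. apply hD.
  destruct (proj1 hs p hp) as (a & b & ha & hab). exists a, b.
  split; [exact ha |]. split; [| exact hab]. apply (hsM a b). now exists p.
Qed.

(** The least closed relation is a set, and it is a fixed point: the pairs
    obtained from it in one step already form a closed relation. *)
Lemma truth_relation : exists W,
  (forall c C, rel W c C <-> truth_set M F P c C) /\
  (forall c C, truth_step M F P W c C <-> rel W c C).
Proof.
  destruct assignment_set as [Ass hAss], (powerset_exists hZ Ass) as [PA hPA].
  (* The full relation V is closed, so the least closed relation lies inside it. *)
  separate_relation V from X to PA by (fun c C => c = c) as hV hV'.
  assert (hVc : forall c C, truth_step M F P V c C -> rel V c C).
  { intros c C [hC h]. apply hV'. split; [| split; [| reflexivity]].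
    - destruct hX as (h0 & h1 & h2 & h3 & h4).
      destruct h as [h | [h | [h | [h | h]]]].
      + destruct h as (i & j & hi & hj & hc & _). eauto.
      + destruct h as (i & j & hi & hj & hc & _). eauto.
      + destruct h as (i & hi & hc & _). eauto.
      + destruct h as (f & g & A & B & hf & hg & hc & _). apply hV' in hf, hg.
        apply (h3 f g); tauto.
      + destruct h as (i & f & A & hi & hf & hc & _). apply hV' in hf.
        apply (h4 i f); tauto.
    - apply hPA. intros s hs. apply hAss. auto. }
  separate_relation W from X to PA by (fun c C => truth_set M F P c C) as hW hW'.
  assert (hWt : forall c C, rel W c C <-> truth_set M F P c C).
  { intros c C. rewrite hW'. split; [tauto |]. intro h.
    specialize (h V hVc) as h'. apply hV' in h'. tauto. }
  assert (hWc : forall c C, truth_step M F P W c C -> rel W c C).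
  { intros c C h. apply hWt. apply (truth_set_intro (W := W)); [| exact h].
    intros f A hf. now apply hWt. }
  exists W. split; [exact hWt |]. intros c C. split; [apply hWc |].
  intro h.
  separate_relation W' from X to PA by (fun c C => truth_step M F P W c C) as h1 h1'.
  assert (hW1 : forall c C, rel W' c C <-> truth_step M F P W c C).
  { intros d D. rewrite h1'. split; [intros (_ & _ & k); exact k |].
    intro k. destruct (proj1 (hW' d D) (hWc d D k)) as (k1 & k2 & _). auto. }
  apply hW1. apply hWt in h. apply h. intros d D hd. apply hW1.
  apply (truth_step_mono (W := W')); [| exact hd].
  intros f A hf. apply hWc. now apply hW1.
Qed.

Ltac compare_codes :=
  match goal with
  | h1 : is_code _ ?c _ _, h2 : is_code _ ?c _ _ |- _ =>
    destruct (code_inj h1 h2) as (htag & hfst & hsnd); first [discriminate htag | subst]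
  end.

Ltac step_cases h :=
  destruct h as [_ [(i' & j' & _ & _ & hc' & h) | [(i' & j' & _ & _ & hc' & h) |
    [(i' & _ & hc' & h) | [(f' & g' & A' & B' & hf' & hg' & hc' & h) |
      (i' & f' & A' & _ & hf' & hc' & h)]]]]]; compare_codes.

Lemma truth_step_mem W c C i j : truth_step M F P W c C -> is_code 0 c i j ->
  forall s, assignment s M -> (s ∈ C <-> exists a b, rel s i a /\ rel s j b /\ rel F a b).
Proof. intros h hc. step_cases h. exact h. Qed.

Lemma truth_step_eq W c C i j : truth_step M F P W c C -> is_code 1 c i j ->
  forall s, assignment s M -> (s ∈ C <-> exists a, rel s i a /\ rel s j a).
Proof. intros h hc. step_cases h. exact h. Qed.

Lemma truth_step_pred W c C i : truth_step M F P W c C -> is_code 2 c i i ->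
  forall s, assignment s M -> (s ∈ C <-> exists a, rel s i a /\ a ∈ P).
Proof. intros h hc. step_cases h. exact h. Qed.

Lemma truth_step_nand W c C f g : truth_step M F P W c C -> is_code 3 c f g ->
  exists A B, rel W f A /\ rel W g B /\
    forall s, assignment s M -> (s ∈ C <-> ~ (s ∈ A /\ s ∈ B)).
Proof. intros h hc. step_cases h. eauto. Qed.

Lemma truth_step_ex W c C i f : truth_step M F P W c C -> is_code 4 c i f ->
  exists A, rel W f A /\ forall s, assignment s M ->
    (s ∈ C <-> exists a s', a ∈ M /\ assignment s' M /\ is_update s' s i a /\ s' ∈ A).
Proof. intros h hc. step_cases h. eauto. Qed.

(** By induction on formulas every formula has exactly one truth set: existence
    follows from closure, uniqueness from inversion and the unique readability
    of codes.  The set [X], closed under the formation of codes, is an ambient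
    set in which formulas can be collected. *)
Lemma satisfaction_exists : exists T, is_satisfaction T M F P.
Proof.
  destruct truth_relation as (W & hWt & hW).
  destruct assignment_set as [Ass hAss].
  pose proof hX as hX'. destruct hX' as (hX0 & hX1 & hX2 & hX3 & hX4).
  assert (hext : forall c C C', rel W c C -> rel W c C' ->
    (forall s, assignment s M -> s ∈ C <-> s ∈ C') -> C = C').
  { intros c C C' h h' k. apply hW in h as [h _], h' as [h' _].
    apply (set_ext hZ). intro s. split; intro hs; apply k; auto. }
  assert (hXf : forall c, is_formula c -> c ∈ X) by (intros c hc; exact (hc X hX)).
  assert (hex : forall c, is_formula c -> exists C, rel W c C).
  { separate Y from X by (fun c => exists C, rel W c C) as hY.
    intros c hc. enough (c ∈ Y) by (apply hY; assumption). apply hc.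
    split; [| split; [| split; [| split]]].
    - intros i j d hi hj hd. apply hY. split; [eauto |].
      separate C from Ass by
        (fun s => exists a b, rel s i a /\ rel s j b /\ rel F a b) as hC.
      exists C. apply hW. split; [intros s hs; apply hC in hs; now apply hAss |].
      left. exists i, j. split; [exact hi | split; [exact hj | split; [exact hd |]]].
      intros s hs. rewrite hC, hAss. tauto.
    - intros i j d hi hj hd. apply hY. split; [eauto |].
      separate C from Ass by (fun s => exists a, rel s i a /\ rel s j a) as hC.
      exists C. apply hW. split; [intros s hs; apply hC in hs; now apply hAss |].
      right; left. exists i, j. split; [exact hi | split; [exact hj | split; [exact hd |]]].
      intros s hs. rewrite hC, hAss. tauto.
    - intros i d hi hd. apply hY. split; [eauto |].
      separate C from Ass by (fun s => exists a, rel s i a /\ a ∈ P) as hC.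
      exists C. apply hW. split; [intros s hs; apply hC in hs; now apply hAss |].
      right; right; left. exists i. split; [exact hi | split; [exact hd |]].
      intros s hs. rewrite hC, hAss. tauto.
    - intros f g d hf hg hd. apply hY in hf as (hf & A & hA), hg as (hg & B & hB).
      apply hY. split; [eauto |].
      separate C from Ass by (fun s => ~ (s ∈ A /\ s ∈ B)) as hC.
      exists C. apply hW. split; [intros s hs; apply hC in hs; now apply hAss |].
      right; right; right; left. exists f, g, A, B.
      split; [exact hA | split; [exact hB | split; [exact hd |]]].
      intros s hs. rewrite hC, hAss. tauto.
    - intros i f d hi hf hd. apply hY in hf as (hf & A & hA).
      apply hY. split; [eauto |].
      separate C from Ass by
        (fun s => exists a s', a ∈ M /\ assignment s' M /\ is_update s' s i a /\ s' ∈ A)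
        as hC.
      exists C. apply hW. split; [intros s hs; apply hC in hs; now apply hAss |].
      right; right; right; right. exists i, f, A.
      split; [exact hi | split; [exact hA | split; [exact hd |]]].
      intros s hs. rewrite hC, hAss. tauto. }
  assert (hun : forall c, is_formula c -> forall C C', rel W c C -> rel W c C' -> C = C').
  { separate Y from X by (fun c => forall C C', rel W c C -> rel W c C' -> C = C') as hY.
    intros c hc. enough (c ∈ Y) by (apply hY; assumption). apply hc.
    split; [| split; [| split; [| split]]].
    - intros i j d hi hj hd. apply hY. split; [eauto |]. intros C C' h h'.
      apply (hext d); [exact h | exact h' |]. intros s hs. apply hW in h, h'.
      now rewrite (truth_step_mem h hd hs), (truth_step_mem h' hd hs).
    - intros i j d hi hj hd. apply hY. split; [eauto |]. intros C C' h h'.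
      apply (hext d); [exact h | exact h' |]. intros s hs. apply hW in h, h'.
      now rewrite (truth_step_eq h hd hs), (truth_step_eq h' hd hs).
    - intros i d hi hd. apply hY. split; [eauto |]. intros C C' h h'.
      apply (hext d); [exact h | exact h' |]. intros s hs. apply hW in h, h'.
      now rewrite (truth_step_pred h hd hs), (truth_step_pred h' hd hs).
    - intros f g d hf hg hd. apply hY in hf as [hf huf], hg as [hg hug].
      apply hY. split; [eauto |]. intros C C' h h'.
      apply (hext d); [exact h | exact h' |]. intros s hs. apply hW in h, h'.
      destruct (truth_step_nand h hd) as (A & B & hA & hB & hC).
      destruct (truth_step_nand h' hd) as (A' & B' & hA' & hB' & hC').
      now rewrite (hC s hs), (hC' s hs), (huf A A' hA hA'), (hug B B' hB hB').
    - intros i f d hi hf hd. apply hY in hf as [hf huf].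
      apply hY. split; [eauto |]. intros C C' h h'.
      apply (hext d); [exact h | exact h' |]. intros s hs. apply hW in h, h'.
      destruct (truth_step_ex h hd) as (A & hA & hC).
      destruct (truth_step_ex h' hd) as (A' & hA' & hC').
      now rewrite (hC s hs), (hC' s hs), (huf A A' hA hA'). }
  separate_relation T from X to Ass by (fun c s => exists C, rel W c C /\ s ∈ C) as hT hT'.
  assert (hTC : forall c C s, is_formula c -> rel W c C -> rel T c s <-> s ∈ C).
  { intros c C s hc hC. rewrite hT'. split.
    - intros (_ & _ & C' & hC' & hs). now rewrite (hun c hc C C' hC hC').
    - intro hs. split; [auto |]. split; [| eauto].
      apply hAss. apply hW in hC. now apply hC. }
  exists T. intros s hs. split; [| split; [| split; [| split]]].
  - intros i j c hi hj hc.
    assert (hf : is_formula c) by (intros Y (hY & _); eauto).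
    destruct (hex c hf) as [C hC]. rewrite (hTC c C s hf hC). apply hW in hC.
    exact (truth_step_mem hC hc hs).
  - intros i j c hi hj hc.
    assert (hf : is_formula c) by (intros Y (_ & hY & _); eauto).
    destruct (hex c hf) as [C hC]. rewrite (hTC c C s hf hC). apply hW in hC.
    exact (truth_step_eq hC hc hs).
  - intros i c hi hc.
    assert (hf : is_formula c) by (intros Y (_ & _ & hY & _); eauto).
    destruct (hex c hf) as [C hC]. rewrite (hTC c C s hf hC). apply hW in hC.
    exact (truth_step_pred hC hc hs).
  - intros f g c hf hg hc.
    assert (hfc : is_formula c).
    { intros Y hY. apply (proj1 (proj2 (proj2 (proj2 hY))) f g); auto. }
    destruct (hex c hfc) as [C hC]. rewrite (hTC c C s hfc hC). apply hW in hC.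
    destruct (truth_step_nand hC hc) as (A & B & hA & hB & h).
    rewrite (h s hs), (hTC f A s hf hA), (hTC g B s hg hB). reflexivity.
  - intros i f c hi hf hc.
    assert (hfc : is_formula c).
    { intros Y hY. apply (proj2 (proj2 (proj2 (proj2 hY))) i f); auto. }
    destruct (hex c hfc) as [C hC]. rewrite (hTC c C s hfc hC). apply hW in hC.
    destruct (truth_step_ex hC hc) as (A & hA & h).
    rewrite (h s hs). split; intros (a & s' & h1 & h2 & h3 & h4);
      exists a, s'; (split; [exact h1 | split; [exact h2 | split; [exact h3 |]]]);
      now apply (hTC f A s' hf hA).
Qed.

End Satisfaction.

(** * Codes of standard formulas *)

(** The set structure [(M, F)] seen as a structure of its own, in which external
    formulas can be evaluated. *)
Definition internal_structure {U : membership_structure} (M F : U) : membership_structure :=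
  {| carrier := {x : U | x ∈ M};
     mem := fun a b => rel F (proj1_sig a) (proj1_sig b) |}.

(** The name of the variable with de Bruijn index [i] under [d] quantifiers.
    The quantifier at depth [l] binds the odd variable [2 l + 1], and the free variables
    are the even ones, so that no name is captured. *)
Definition variable_of (d i : nat) : nat :=
  if i <? d then 2 * (d - 1 - i) + 1 else 2 * (i - d).

Lemma variable_of_zero d : variable_of (S d) 0 = 2 * d + 1.
Proof. unfold variable_of. cbn [Nat.ltb Nat.leb]. f_equal. lia. Qed.

Lemma variable_of_succ d i : variable_of (S d) (S i) = variable_of d i.
Proof.
  unfold variable_of. destruct (Nat.ltb_spec i d), (Nat.ltb_spec (S i) (S d)); lia.
Qed.

Lemma variable_of_fresh d i : variable_of d i <> 2 * d + 1.
Proof. unfold variable_of. destruct (Nat.ltb_spec i d); lia. Qed.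

Section Codes.
Context {U : membership_structure} (hZ : ZFC U).

Lemma assignment_functional (s M n a b : U) :
  assignment s M -> rel s n a -> rel s n b -> a = b.
Proof. intros (w & _ & hs & _). apply hs. Qed.

Lemma update_exists (s M i a : U) : assignment s M -> is_nat i -> a ∈ M ->
  exists s', assignment s' M /\ is_update s' s i a.
Proof.
  intros (w & hw & hs & hsM) hi ha.
  separate_relation s' from w to M by
    (fun j b => j = i /\ b = a \/ ~ j = i /\ rel s j b) as h h'.
  assert (hu : is_update s' s i a).
  { intros j b. rewrite h'. split; [intros (_ & _ & k); exact k |].
    intros [[-> ->] | [hj hb]].
    - split; [now apply hw | auto].
    - split; [exact (fun_on_dom hZ hs hb) |]. split; [exact (hsM j b hb) | auto]. }
  exists s'. split; [| exact hu]. exists w. split; [exact hw |]. split.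
  - apply (fun_on_of_rel h).
    + intros j hj. destruct (classic (j = i)) as [-> | hn].
      * exists a. apply hu. auto.
      * destruct (proj1 (proj2 hs) j hj) as [b hb]. exists b. apply hu. auto.
    + intros j b b' hb hb'. apply hu in hb, hb'.
      destruct hb as [[h1 h2] | [h1 h2]], hb' as [[h3 h4] | [h3 h4]];
        [congruence | tauto | tauto |].
      exact (proj2 (proj2 hs) j b b' h2 h4).
  - intros j b hb. apply h' in hb. tauto.
Qed.

Lemma constant_assignment (M a : U) : a ∈ M ->
  exists s, assignment s M /\ forall i, is_nat i -> rel s i a.
Proof.
  intro ha. destruct (omega_exists hZ) as [w hw].
  separate_relation s from w to M by (fun i b => b = a) as h h'.
  exists s. split.
  - exists w. split; [exact hw |]. split; [| intros i b hb; apply h' in hb; tauto].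
    apply (fun_on_of_rel h).
    + intros i hi. exists a. apply h'. auto.
    + intros i b b' hb hb'. apply h' in hb, hb'.
      destruct hb as (_ & _ & ->), hb' as (_ & _ & ->). reflexivity.
  - intros i hi. apply h'. split; [now apply hw | auto].
Qed.

Lemma nand_formula (f g : U) : is_formula f -> is_formula g ->
  exists c, is_formula c /\ forall T M F P s, is_satisfaction T M F P -> assignment s M ->
    (rel T c s <-> ~ (rel T f s /\ rel T g s)).
Proof.
  intros hf hg. destruct (code_exists hZ 3 f g) as [c hc]. exists c. split.
  - intros Y hY. apply (proj1 (proj2 (proj2 (proj2 hY))) f g); auto.
  - intros T M F P s hT hs.
    destruct (hT s hs) as (_ & _ & _ & h & _). exact (h f g c hf hg hc).
Qed.

Lemma not_formula (f : U) : is_formula f ->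
  exists c, is_formula c /\ forall T M F P s, is_satisfaction T M F P -> assignment s M ->
    (rel T c s <-> ~ rel T f s).
Proof.
  intro hf. destruct (nand_formula hf hf) as (c & hc & h). exists c. split; [exact hc |].
  intros T M F P s hT hs. rewrite (h T M F P s hT hs). tauto.
Qed.

Lemma ex_formula (i f : U) : is_nat i -> is_formula f ->
  exists c, is_formula c /\ forall T M F P s, is_satisfaction T M F P -> assignment s M ->
    (rel T c s <-> exists a s', a ∈ M /\ assignment s' M /\ is_update s' s i a /\ rel T f s').
Proof.
  intros hi hf. destruct (code_exists hZ 4 i f) as [c hc]. exists c. split.
  - intros Y hY. apply (proj2 (proj2 (proj2 (proj2 hY))) i f); auto.
  - intros T M F P s hT hs.
    destruct (hT s hs) as (_ & _ & _ & _ & h). exact (h i f c hi hf hc).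
Qed.

(** Negated conjunction and existential quantification, the primitives of the
    internal language, express implication and universal quantification classically. *)
Lemma formula_code_exists (phi : fo_formula) (d : nat) :
  exists c : U, is_formula c /\
  forall T M F P s (e : nat -> internal_structure M F),
    is_satisfaction T M F P -> assignment s M ->
    (forall i n, is_numeral (variable_of d i) n -> rel s n (proj1_sig (e i))) ->
    (rel T c s <-> holds e phi).
Proof.
  revert d. induction phi as [i j | i j | | p IHp q IHq | p IHp]; intro d.
  - destruct (numeral_exists hZ (variable_of d i)) as [n hn],
      (numeral_exists hZ (variable_of d j)) as [m hm], (code_exists hZ 0 n m) as [c hc].
    pose proof (numeral_nat hn) as hn'. pose proof (numeral_nat hm) as hm'.
    exists c. split; [intros Y (hY & _); eauto |].
    intros T M F P s e hT hs he. rewrite (proj1 (hT s hs) n m c hn' hm' hc).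
    cbn. split.
    + intros (a & b & ha & hb & hab).
      now rewrite <- (assignment_functional hs ha (he i n hn)),
        <- (assignment_functional hs hb (he j m hm)).
    + intro h. exists (proj1_sig (e i)), (proj1_sig (e j)). auto.
  - destruct (numeral_exists hZ (variable_of d i)) as [n hn],
      (numeral_exists hZ (variable_of d j)) as [m hm], (code_exists hZ 1 n m) as [c hc].
    pose proof (numeral_nat hn) as hn'. pose proof (numeral_nat hm) as hm'.
    exists c. split; [intros Y (_ & hY & _); eauto |].
    intros T M F P s e hT hs he. rewrite (proj1 (proj2 (hT s hs)) n m c hn' hm' hc).
    cbn. split.
    + intros (a & ha & hb).
      pose proof (assignment_functional hs ha (he i n hn)) as h1.
      pose proof (assignment_functional hs hb (he j m hm)) as h2.
      destruct (e i) as [x hx], (e j) as [y hy]. cbn in h1, h2. subst x y.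
      f_equal. apply proof_irrelevance.
    + intro h. exists (proj1_sig (e i)). split; [auto |]. rewrite h. auto.
  - destruct (numeral_exists hZ 0) as [n hn], (code_exists hZ 1 n n) as [t ht].
    pose proof (numeral_nat hn) as hn'.
    assert (hft : is_formula t) by (intros Y (_ & hY & _); eauto).
    destruct (not_formula hft) as (c & hc & h). exists c. split; [exact hc |].
    intros T M F P s e hT hs he. rewrite (h T M F P s hT hs).
    rewrite (proj1 (proj2 (hT s hs)) n n t hn' hn' ht). cbn. split; [| tauto].
    intro k. apply k. destruct hs as (w & hw & hs & _).
    destruct (proj1 (proj2 hs) n (proj2 (hw n) hn')) as [a ha]. eauto.
  - destruct (IHp d) as (cp & hcp & hp), (IHq d) as (cq & hcq & hq).
    destruct (not_formula hcq) as (nq & hnq & h1), (nand_formula hcp hnq) as (c & hc & h2).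
    exists c. split; [exact hc |]. intros T M F P s e hT hs he.
    rewrite (h2 T M F P s hT hs), (h1 T M F P s hT hs),
      (hp T M F P s e hT hs he), (hq T M F P s e hT hs he). cbn. tauto.
  - destruct (IHp (S d)) as (cp & hcp & hp).
    destruct (numeral_exists hZ (2 * d + 1)) as [v hv].
    destruct (not_formula hcp) as (np & hnp & h1),
      (ex_formula (numeral_nat hv) hnp) as (ep & hep & h2),
      (not_formula hep) as (c & hc & h3).
    exists c. split; [exact hc |]. intros T M F P s e hT hs he.
    rewrite (h3 T M F P s hT hs), (h2 T M F P s hT hs). cbn.
    assert (key : forall (a : internal_structure M F) s', assignment s' M -> is_update s' s v (proj1_sig a) ->
      rel T cp s' <-> holds (scons a e) p).
    { intros a s' hs' hu. apply (hp T M F P s' (scons a e) hT hs').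
      intros [| i] n hn.
      - rewrite variable_of_zero in hn. cbn. apply hu. left.
        split; [exact (numeral_unique hZ hn hv) | reflexivity].
      - rewrite variable_of_succ in hn. cbn. apply hu. right.
        split; [| exact (he i n hn)]. intros ->.
        exact (variable_of_fresh (numeral_inj hZ hn hv)). }
    split.
    + intros k a. apply NNPP. intro ka. apply k.
      destruct (update_exists hs (numeral_nat hv) (proj2_sig a)) as (s' & hs' & hu).
      exists (proj1_sig a), s'. split; [apply (proj2_sig a) |].
      split; [exact hs' | split; [exact hu |]].
      rewrite (h1 T M F P s' hT hs'). now rewrite (key a s' hs' hu).
    + intros k (a & s' & ha & hs' & hu & hr).
      rewrite (h1 T M F P s' hT hs') in hr. apply hr.
      apply (key (exist _ a ha) s' hs' hu). apply k.
Qed.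

(** A constant assignment evaluates a sentence.  A satisfaction relation is constructed
    for the smaller structure only; one for the extension comes out of
    the elementarity. *)
Lemma elementary_sentence (M E S N F S' : U) (P : forall V : membership_structure, Prop) :
  first_order (fun V _ => P V) ->
  (exists X : U, formula_closed X) -> (exists a, a ∈ M) ->
  elementary_extension M E S N F S' ->
  P (internal_structure M E) -> P (internal_structure N F).
Proof.
  intros [phi hphi] [X hX] [a ha] [hMN hel] hP.
  destruct (formula_code_exists phi 0) as (c & hc & h).
  destruct (constant_assignment ha) as (s & hs & hsa).
  destruct (satisfaction_exists hZ (M := M) (F := E) (P := S) hX) as [T hT].
  assert (hm : models M E S c s).
  { exists T. split; [exact hT |].
    apply (h T M E S s (fun _ => exist _ a ha) hT hs).
    - intros i n hn. apply hsa. exact (numeral_nat hn).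
    - now apply hphi. }
  apply hel in hm as (T' & hT' & hr); [| exact hc | exact hs].
  assert (hs' : assignment s N).
  { destruct hs as (w & hw & hs & hsM). exists w. split; [exact hw |].
    split; [exact hs |]. intros i b hb. apply hMN. eauto. }
  apply (h T' N F S' s (fun _ => exist _ a (hMN a ha)) hT' hs') in hr.
  - now apply hphi in hr.
  - intros i n hn. apply hsa. exact (numeral_nat hn).
Qed.

End Codes.

(** * Subtlety in a form that passes to transitive models *)

(** Subtlety with [omega ∈ t] and strong limitness rewritten: some [w ∈ t] contains
    the empty set and is closed under successors, and no power set of an [l ∈ t]
    receives an injection from [t].  These forms pass to transitive models. *)
Definition locally_subtle {U : membership_structure} (t : U) : Prop :=
  ordinal t /\
  (forall l f, l ∈ t -> ~ (is_fun f t l /\ injective f)) /\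
  (exists w, w ∈ t /\ (exists z, z ∈ w /\ is_empty z) /\
     forall x, x ∈ w -> exists y, y ∈ w /\ is_succ y x) /\
  regular t /\
  (forall l g, l ∈ t ->
     ~ (fun_on g t /\ (forall a b, rel g a b -> subset b l) /\ injective g)) /\
  (forall S C, fun_on S t -> (forall a Sa, rel S a Sa -> subset Sa a) -> club C t ->
     exists b g Sb Sg,
       b ∈ C /\ g ∈ C /\ b ∈ g /\ rel S b Sb /\ rel S g Sg /\
       forall x, (x ∈ Sg /\ x ∈ b) <-> x ∈ Sb).

#[export] Hint Unfold locally_subtle : fo.

Section LocalSubtlety.
Context {U : membership_structure} (hZ : ZFC U).

(** An injection of [t] into the power set of [l] would compose with an injection
    of the latter into an ordinal below [t]. *)
Lemma subtle_locally_subtle (t : U) : subtle t -> locally_subtle t.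
Proof.
  intros [(hcard & (w & hw & hwt) & hreg & hsl) hS].
  split; [apply hcard | split; [apply hcard | split; [| split; [exact hreg | split; [| exact hS]]]]].
  - exists w. split; [exact hwt |]. split.
    + destruct (empty_exists hZ) as [o ho]. exists o. split; [| exact ho].
      apply hw. now apply nat_zero.
    + intros x hx. destruct (succ_exists hZ x) as [y hy]. exists y.
      split; [| exact hy]. apply hw. apply hw in hx. exact (nat_succ hx hy).
  - intros l g hl (hg & hgl & hinj).
    destruct (powerset_exists hZ l) as [p hp].
    destruct (hsl l p hl hp) as (m & f & hm & [hf hfm] & hfi).
    separate_relation h from t to m by (fun a c => exists b, rel g a b /\ rel f b c) as hh hh'.
    apply (proj2 hcard m h hm). split; [split |].
    + apply (fun_on_of_rel hh).
      * intros a ha. destruct (proj1 (proj2 hg) a ha) as [b hb].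
        destruct (proj1 (proj2 hf) b) as [c hc].
        { apply hp. exact (hgl a b hb). }
        exists c. apply hh'. split; [exact ha |]. split; [exact (hfm b c hc) | eauto].
      * intros a c c' hc hc'. apply hh' in hc as (_ & _ & b & hab & hbc).
        apply hh' in hc' as (_ & _ & b' & hab' & hbc').
        rewrite (proj2 (proj2 hg) a b' b hab' hab) in hbc'.
        exact (proj2 (proj2 hf) b c c' hbc hbc').
    + intros a c hc. apply hh' in hc. tauto.
    + intros a a' c hc hc'. apply hh' in hc as (_ & _ & b & hab & hbc).
      apply hh' in hc' as (_ & _ & b' & hab' & hbc').
      rewrite (hfi b' b c hbc' hbc) in hab'. exact (hinj a a' b hab hab').
Qed.

Lemma omega_subset (w w0 : U) : is_omega w ->
  (exists z, z ∈ w0 /\ is_empty z) ->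
  (forall x, x ∈ w0 -> exists y, y ∈ w0 /\ is_succ y x) -> subset w w0.
Proof.
  intros hw [z [hz hze]] hs n hn. apply hw in hn. apply hn. split.
  - intros z' hz'. now rewrite (empty_unique hZ hz' hze).
  - intros x y hx hy. destruct (hs x hx) as (y' & hy' & hy'').
    now rewrite (succ_unique hZ hy hy'').
Qed.

(** Strong limitness: by comparability either [t] injects into the power set
    of [l], which is excluded, or this power set injects into an ordinal below [t]. *)
Lemma locally_subtle_subtle (t : U) : locally_subtle t -> subtle t.
Proof.
  intros (hord & hcard & (w0 & hw0 & hz0 & hs0) & hreg & hpow & hS).
  assert (hom : exists w, is_omega w /\ w ∈ t).
  { destruct (omega_exists hZ) as [w hw]. exists w. split; [exact hw |].
    destruct (ordinal_subset hZ (omega_ordinal hZ hw) (ordinal_elt hord hw0)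
      (omega_subset hw hz0 hs0)) as [-> | h]; [exact hw0 |].
    exact (proj1 hord w0 hw0 w h). }
  split; [| exact hS]. split; [split; [exact hord | exact hcard] |].
  split; [exact hom |]. split; [exact hreg |].
  intros l p hl hp.
  destruct (ordinal_set_comparable hZ p hord (regular_limit hZ hord hom hreg))
    as [(f & [hf hfp] & hfi) | h].
  - case (hpow l f hl). split; [exact hf | split; [| exact hfi]].
    intros a b hab. apply hp. exact (hfp a b hab).
  - destruct h as (m & g & hm & hg & hgi). exists m, g. auto.
Qed.

End LocalSubtlety.

(** * Absoluteness for transitive embeddings *)

(** Up to isomorphism, the inclusion of a transitive class.  It covers both the
    inclusion of [R(k)] and the collapse of a well-founded extension. *)
Definition transitive_embedding {M U : membership_structure} (j : M -> U) : Prop :=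
  (forall x y, j x = j y -> x = y) /\
  (forall x y, x ∈ y <-> j x ∈ j y) /\
  (forall x u, u ∈ j x -> exists y, u = j y).

Section Absoluteness.
Context {M U : membership_structure} (hZ : ZFC U) {j : M -> U}
  (hj : transitive_embedding j).

Lemma emb_inj x y : j x = j y -> x = y.
Proof. apply hj. Qed.
Lemma emb_mem x y : x ∈ y <-> j x ∈ j y.
Proof. apply hj. Qed.
Lemma emb_elt x u : u ∈ j x -> exists y, u = j y /\ y ∈ x.
Proof.
  intro h. destruct (proj2 (proj2 hj) x u h) as [y ->]. exists y.
  split; [reflexivity |]. now apply emb_mem.
Qed.

Lemma emb_empty x : is_empty x <-> is_empty (j x).
Proof.
  split; intros h z hz.
  - destruct (emb_elt hz) as (y & _ & hy). exact (h y hy).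
  - apply emb_mem in hz. exact (h _ hz).
Qed.

Lemma emb_subset x y : subset x y <-> subset (j x) (j y).
Proof.
  split; intros h z hz.
  - destruct (emb_elt hz) as (z' & -> & hz'). apply emb_mem. auto.
  - apply emb_mem. apply h. now apply emb_mem.
Qed.

Lemma emb_transitive x : transitive x <-> transitive (j x).
Proof.
  split; intros h y hy.
  - destruct (emb_elt hy) as (y' & -> & hy'). apply emb_subset. auto.
  - apply emb_subset. apply h. now apply emb_mem.
Qed.

Lemma emb_ordinal x : ordinal x <-> ordinal (j x).
Proof.
  unfold ordinal. rewrite <- emb_transitive. split; intros [h k]; split; auto; intros y hy.
  - destruct (emb_elt hy) as (y' & -> & hy'). apply emb_transitive. auto.
  - apply emb_transitive. apply k. now apply emb_mem.
Qed.

Lemma emb_succ x y : is_succ y x <-> is_succ (j y) (j x).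
Proof.
  split; intros h z.
  - split.
    + intro hz. destruct (emb_elt hz) as (z' & -> & hz'). apply h in hz' as [hz' | ->].
      * left. now apply emb_mem.
      * now right.
    + intros [hz | ->].
      * destruct (emb_elt hz) as (z' & -> & hz'). apply emb_mem, h. now left.
      * apply emb_mem, h. now right.
  - rewrite emb_mem, (h (j z)), <- emb_mem. split; intros [k | k]; auto.
    + right. now apply emb_inj.
    + subst z. now right.
Qed.

Lemma emb_upair p a b : is_upair p a b <-> is_upair (j p) (j a) (j b).
Proof.
  split; intros h z.
  - split.
    + intro hz. destruct (emb_elt hz) as (z' & -> & hz').
      apply h in hz' as [-> | ->]; auto.
    + intros [-> | ->]; apply emb_mem, h; auto.
  - rewrite emb_mem, (h (j z)). split; intros [k | k]; try (subst z; auto);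
      [left | right]; now apply emb_inj.
Qed.

(** The two components of a Kuratowski pair lie in its transitive closure,
    hence in the image. *)
Lemma emb_pair p a b : is_pair p a b <-> is_pair (j p) (j a) (j b).
Proof.
  split.
  - intros (u & v & hu & hv & hp). exists (j u), (j v).
    rewrite <- !emb_upair. auto.
  - intros (u & v & hu & hv & hp).
    destruct (emb_elt (x := p) (u := u)) as (u' & -> & _); [apply hp; auto |].
    destruct (emb_elt (x := p) (u := v)) as (v' & -> & _); [apply hp; auto |].
    exists u', v'. rewrite !emb_upair. auto.
Qed.

Lemma emb_pair_elt p a b : is_pair (j p) a b -> exists a' b', a = j a' /\ b = j b'.
Proof.
  intros (u & v & hu & hv & hp).
  destruct (emb_elt (x := p) (u := v)) as (v' & -> & _); [apply hp; auto |].
  destruct (emb_elt (x := v') (u := a)) as (a' & -> & _); [apply hv; auto |].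
  destruct (emb_elt (x := v') (u := b)) as (b' & -> & _); [apply hv; auto |].
  eauto.
Qed.

Lemma emb_rel_elt r a b : rel (j r) a b ->
  exists a' b', a = j a' /\ b = j b' /\ rel r a' b'.
Proof.
  intros (p & hp & hpr). destruct (emb_elt hpr) as (p' & -> & hp').
  destruct (emb_pair_elt hp) as (a' & b' & -> & ->). exists a', b'.
  split; [reflexivity | split; [reflexivity |]]. exists p'. now rewrite emb_pair.
Qed.

Lemma emb_rel r a b : rel r a b <-> rel (j r) (j a) (j b).
Proof.
  split.
  - intros (p & hp & hpr). exists (j p). now rewrite <- emb_pair, <- emb_mem.
  - intro h. destruct (emb_rel_elt h) as (a' & b' & ha & hb & k).
    now rewrite (emb_inj ha), (emb_inj hb).
Qed.

Lemma emb_fun_on f A : fun_on f A <-> fun_on (j f) (j A).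
Proof.
  split; intros (h1 & h2 & h3); (split; [| split]).
  - intros p hp. destruct (emb_elt hp) as (p' & -> & hp').
    destruct (h1 p' hp') as (a & b & ha & hab). exists (j a), (j b).
    now rewrite <- emb_pair, <- emb_mem.
  - intros a ha. destruct (emb_elt ha) as (a' & -> & ha').
    destruct (h2 a' ha') as [b hb]. exists (j b). now apply emb_rel.
  - intros a b b' hb hb'. destruct (emb_rel_elt hb) as (x & y & -> & -> & k).
    destruct (emb_rel_elt hb') as (x' & y' & hx & -> & k').
    apply emb_inj in hx. subst x'. now rewrite (h3 x y y' k k').
  - intros p hp. apply emb_mem in hp as hp'.
    destruct (h1 _ hp') as (a & b & ha & hab).
    destruct (emb_pair_elt hab) as (a' & b' & -> & ->). exists a', b'.
    now rewrite emb_pair, emb_mem.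
  - intros a ha. apply emb_mem in ha. destruct (h2 _ ha) as [b hb].
    destruct (emb_rel_elt hb) as (x & y & hx & -> & k).
    apply emb_inj in hx. subst x. eauto.
  - intros a b b' hb hb'. apply emb_rel in hb, hb'. apply emb_inj. eauto.
Qed.

Lemma emb_is_fun f A B : is_fun f A B <-> is_fun (j f) (j A) (j B).
Proof.
  unfold is_fun. rewrite <- emb_fun_on. split; intros [h k]; split; auto; intros a b hab.
  - destruct (emb_rel_elt hab) as (x & y & -> & -> & q). apply emb_mem. eauto.
  - apply emb_mem. apply emb_rel in hab. eauto.
Qed.

Lemma emb_injective f : injective f <-> injective (j f).
Proof.
  split; intros h a a' b hab hab'.
  - destruct (emb_rel_elt hab) as (x & y & -> & -> & q).
    destruct (emb_rel_elt hab') as (x' & y' & -> & hy & q').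
    apply emb_inj in hy. subst y'. now rewrite (h x x' y q q').
  - apply emb_rel in hab, hab'. apply emb_inj. eauto.
Qed.

Lemma emb_values_below g l : (forall a b, rel g a b -> subset b l) <->
  (forall a b, rel (j g) a b -> subset b (j l)).
Proof.
  split; intros h a b hab.
  - destruct (emb_rel_elt hab) as (x & y & -> & -> & q). apply emb_subset. eauto.
  - apply emb_subset. apply emb_rel in hab. eauto.
Qed.

Lemma emb_regressive S : (forall a Sa, rel S a Sa -> subset Sa a) <->
  (forall a Sa, rel (j S) a Sa -> subset Sa a).
Proof.
  split; intros h a b hab.
  - destruct (emb_rel_elt hab) as (x & y & -> & -> & q). apply emb_subset. eauto.
  - apply emb_subset. apply emb_rel in hab. eauto.
Qed.

Lemma emb_unbounded C l : unbounded_in C l <-> unbounded_in (j C) (j l).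
Proof.
  split; intros h x hx.
  - destruct (emb_elt hx) as (x' & -> & hx'). destruct (h x' hx') as (c & h1 & h2 & h3).
    exists (j c). now rewrite <- !emb_mem.
  - apply emb_mem in hx. destruct (h _ hx) as (c & h1 & h2 & h3).
    destruct (emb_elt h1) as (c' & -> & _). exists c'. now rewrite !emb_mem.
Qed.

Lemma emb_club C t : club C t <-> club (j C) (j t).
Proof.
  unfold club. rewrite <- emb_subset, <- emb_unbounded.
  split; intros (h1 & h2 & h3); (split; [exact h1 | split; [exact h2 |]]); intros l hl hn hu.
  - destruct (emb_elt hl) as (l' & -> & hl'). apply emb_mem.
    rewrite <- emb_empty in hn. rewrite <- emb_unbounded in hu. auto.
  - apply emb_mem. rewrite emb_empty in hn. rewrite emb_unbounded in hu.
    apply h3; auto. now apply emb_mem.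
Qed.

Lemma emb_regular_bound f b :
  (forall x y, rel f x y -> y ∈ b) <-> (forall x y, rel (j f) x y -> y ∈ j b).
Proof.
  split; intros h x y hxy.
  - destruct (emb_rel_elt hxy) as (x' & y' & -> & -> & q). apply emb_mem. eauto.
  - apply emb_mem. apply emb_rel in hxy. eauto.
Qed.

Lemma emb_limit w :
  ((exists z, z ∈ w /\ is_empty z) /\ forall x, x ∈ w -> exists y, y ∈ w /\ is_succ y x) <->
  ((exists z, z ∈ j w /\ is_empty z) /\
     forall x, x ∈ j w -> exists y, y ∈ j w /\ is_succ y x).
Proof.
  split; intros [(z & hz & hze) h]; split.
  - exists (j z). now rewrite <- emb_mem, <- emb_empty.
  - intros x hx. destruct (emb_elt hx) as (x' & -> & hx').
    destruct (h x' hx') as (y & hy & hs). exists (j y). now rewrite <- emb_mem, <- emb_succ.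
  - destruct (emb_elt hz) as (z' & -> & hz'). exists z'. now rewrite emb_empty.
  - intros x hx. apply emb_mem in hx. destruct (h _ hx) as (y & hy & hs).
    destruct (emb_elt hy) as (y' & -> & hy'). exists y'. now rewrite emb_succ.
Qed.

Lemma emb_coherent b g S Sb Sg :
  (b ∈ g /\ rel S b Sb /\ rel S g Sg /\ forall x, (x ∈ Sg /\ x ∈ b) <-> x ∈ Sb) <->
  (j b ∈ j g /\ rel (j S) (j b) (j Sb) /\ rel (j S) (j g) (j Sg) /\
     forall x, (x ∈ j Sg /\ x ∈ j b) <-> x ∈ j Sb).
Proof.
  rewrite <- !emb_rel, <- emb_mem.
  split; intros (h1 & h2 & h3 & h); (split; [exact h1 | split; [exact h2 |
    split; [exact h3 |]]]); intro x.
  - split.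
    + intros [hx hx']. destruct (emb_elt hx) as (y & -> & hy). rewrite <- emb_mem in *.
      now apply h.
    + intro hx. destruct (emb_elt hx) as (y & -> & hy). rewrite <- !emb_mem. now apply h.
  - rewrite !emb_mem. apply h.
Qed.

(** Universal clauses restrict to the image, and the witnesses that they provide
    lie in transitive closures of sets in the image. *)
Lemma locally_subtle_down t : locally_subtle (j t) -> locally_subtle t.
Proof.
  intros (hord & hcard & (w & hw & hlim) & hreg & hpow & hS).
  split; [now apply emb_ordinal | split; [| split; [| split; [| split]]]].
  - intros l f hl [hf hi]. apply emb_mem in hl. apply (hcard (j l) (j f) hl).
    now rewrite <- emb_is_fun, <- emb_injective.
  - destruct (emb_elt hw) as (w' & -> & hw'). exists w'. split; [exact hw' |].
    now apply emb_limit.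
  - intros l f hl hf. apply emb_mem in hl. apply emb_is_fun in hf.
    destruct (hreg _ _ hl hf) as (b & hb & h). destruct (emb_elt hb) as (b' & -> & hb').
    exists b'. split; [exact hb' |]. now apply emb_regular_bound.
  - intros l g hl (hg & hv & hi). apply emb_mem in hl. apply (hpow (j l) (j g) hl).
    now rewrite <- emb_fun_on, <- emb_values_below, <- emb_injective.
  - intros S C hf hr hC. apply emb_fun_on in hf. apply emb_club in hC.
    rewrite emb_regressive in hr.
    destruct (hS (j S) (j C) hf hr hC) as (b & g & Sb & Sg & hb & hg & hbg & h1 & h2 & h).
    destruct (emb_elt hb) as (b' & -> & hb'), (emb_elt hg) as (g' & -> & hg').
    destruct (emb_rel_elt h1) as (? & Sb' & _ & -> & _),
      (emb_rel_elt h2) as (? & Sg' & _ & -> & _).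
    exists b', g', Sb', Sg'. split; [exact hb' | split; [exact hg' |]].
    apply emb_coherent. auto.
Qed.

(** Ordinals below [t] and the values of a regressive sequence on [t] are subsets of
    [t], so fullness is required only for sets of pairs with such second components. *)
Lemma locally_subtle_up t :
  (forall C, subset C (j t) -> exists C', C = j C') ->
  (forall f, (forall p, p ∈ f -> exists a b, a ∈ j t /\ subset b (j t) /\ is_pair p a b) ->
     exists f', f = j f') ->
  locally_subtle t -> locally_subtle (j t).
Proof.
  intros hsub hfull (hord & hcard & (w & hw & hlim) & hreg & hpow & hS).
  apply emb_ordinal in hord as hord'.
  assert (hfun : forall f A, fun_on f A -> subset A (j t) ->
    (forall a b, rel f a b -> subset b (j t)) -> exists f', f = j f').
  { intros f A hf hA hb. apply hfull. intros p hp.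
    destruct (proj1 hf p hp) as (a & b & ha & hab). exists a, b. split; [auto |].
    split; [| exact hab]. apply (hb a). now exists p. }
  split; [exact hord' | split; [| split; [| split; [| split]]]].
  - intros l f hl [hf hi]. destruct (hfun f (j t)) as [f' ->].
    { apply hf. } { intros z hz; exact hz. }
    { intros a b hab. apply (proj1 hord'). apply (proj1 hord' l hl).
      exact (proj2 hf a b hab). }
    destruct (emb_elt hl) as (l' & -> & hl'). apply (hcard l' f' hl').
    now rewrite emb_is_fun, emb_injective.
  - exists (j w). split; [now apply emb_mem |]. now apply emb_limit.
  - intros l f hl hf. destruct (hfun f l) as [f' ->].
    { apply hf. } { exact (proj1 hord' l hl). }
    { intros a b hab. apply (proj1 hord'). exact (proj2 hf a b hab). }
    destruct (emb_elt hl) as (l' & -> & hl'). apply emb_is_fun in hf.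
    destruct (hreg l' f' hl' hf) as (b & hb & h). exists (j b).
    split; [now apply emb_mem |]. now apply emb_regular_bound.
  - intros l g hl (hg & hv & hi). destruct (hfun g (j t) hg) as [g' ->].
    { intros z hz; exact hz. }
    { intros a b hab z hz. apply (proj1 hord' l hl). exact (hv a b hab z hz). }
    destruct (emb_elt hl) as (l' & -> & hl'). apply (hpow l' g' hl').
    now rewrite emb_fun_on, emb_values_below, emb_injective.
  - intros S C hf hr hC. destruct (hsub C) as [C' ->]; [apply hC |].
    destruct (hfun S (j t) hf) as [S' ->].
    { intros z hz; exact hz. }
    { intros a b hab z hz. apply (proj1 hord' a); [exact (fun_on_dom hZ hf hab) |].
      exact (hr a b hab z hz). }
    apply emb_fun_on in hf. apply emb_club in hC. rewrite <- emb_regressive in hr.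
    destruct (hS S' C' hf hr hC) as (b & g & Sb & Sg & hb & hg & h).
    exists (j b), (j g), (j Sb), (j Sg).
    split; [now apply emb_mem | split; [now apply emb_mem |]].
    now apply emb_coherent.
Qed.

End Absoluteness.

(** * Reflection of subtlety below an unfoldable cardinal *)

Section Reflection.
Context {U : membership_structure} (hZ : ZFC U).

Lemma first_exists (Q : forall V : membership_structure, V -> Prop) :
  first_order (fun V e => Q V (e 0)) ->
  forall k : U, ordinal k -> Q U k ->
  exists k0, (k0 ∈ k \/ k0 = k) /\ is_first (Q U) k0.
Proof.
  intros hQ k hk hQk.
  destruct (separation hZ hQ (fun _ => k) k) as [X hX]. cbn in hX.
  destruct (classic (exists x, x ∈ X)) as [[x hx] | hn].
  - destruct (minimal_element hZ hx) as [k0 [h0 hm]]. apply hX in h0 as [h0 h0'].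
    exists k0. split; [auto |]. split; [exact h0' |].
    intros l hl hl'. apply (hm l hl). apply hX. split; [| exact hl'].
    exact (proj1 hk k0 h0 l hl).
  - exists k. split; [auto |]. split; [exact hQk |].
    intros l hl hl'. apply hn. exists l. now apply hX.
Qed.

Definition extensional (V : membership_structure) : Prop :=
  forall x y : V, (forall z, z ∈ x <-> z ∈ y) -> x = y.

Lemma mem_relation_rel (E R a b : U) : is_mem_relation E R ->
  a ∈ R -> b ∈ R -> (rel E a b <-> a ∈ b).
Proof.
  intros hE ha hb. destruct (pair_exists hZ a b) as [p hp].
  rewrite (rel_pair hZ E hp), (hE p). split.
  - intros (a' & b' & _ & _ & h & hp'). now destruct (pair_inj hZ hp hp') as [-> ->].
  - intro h. exists a, b. auto.
Qed.

Lemma inclusion_embedding (E R : U) : is_mem_relation E R ->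
  (forall x y, x ∈ R -> y ∈ x -> y ∈ R) ->
  transitive_embedding (fun x : internal_structure R E => proj1_sig x).
Proof.
  intros hE hR. split; [| split].
  - intros [x hx] [y hy] h. cbn in h. subst y. f_equal. apply proof_irrelevance.
  - intros [x hx] [y hy]. cbn. now apply mem_relation_rel with (R := R).
  - intros [x hx] u hu. cbn in hu. exists (exist _ u (hR x u hx hu)). reflexivity.
Qed.

Lemma embedding_extensional (M : membership_structure) (j : M -> U) :
  transitive_embedding j -> extensional M.
Proof.
  intros hj x y h. apply (emb_inj hj). apply (set_ext hZ). intro z. split; intro hz.
  - destruct (emb_elt hj hz) as (z' & -> & hz'). apply (emb_mem hj). now apply h.
  - destruct (emb_elt hj hz) as (z' & -> & hz'). apply (emb_mem hj). now apply h.
Qed.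

(** Extensionality makes the collapse injective: take an [F]-minimal [x] that shares its
    value with another [y]; then [x] and [y] have the same [F]-predecessors. *)
Lemma collapse_embedding (N F P pi : U) :
  is_structure N F P -> wellfounded N F -> is_collapse pi N F ->
  extensional (internal_structure N F) ->
  exists j : internal_structure N F -> U,
    transitive_embedding j /\ forall x, rel pi (proj1_sig x) (j x).
Proof.
  intros (_ & hF & _) hwf [hpi hc] hext.
  assert (hdom : forall a b, rel F a b -> a ∈ N /\ b ∈ N).
  { intros a b (p & hp & hpF). destruct (hF p hpF) as (a' & b' & ha & hb & hp').
    now destruct (pair_inj hZ hp hp') as [-> ->]. }
  assert (hinj : forall x y v, rel pi x v -> rel pi y v -> x = y).
  { intros x0 y0 v0 hx0 hy0. apply NNPP. intro hn.
    separate D from N by (fun x => exists y v, rel pi x v /\ rel pi y v /\ ~ x = y) as hD.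
    destruct (hwf D) as (x & hx & hm).
    { intros z hz. now apply hD in hz. }
    { exists x0. apply hD. split; [exact (fun_on_dom hZ hpi hx0) | eauto 10]. }
    apply hD in hx as (hxN & y & v & hx & hy & hxy). apply hxy.
    assert (hyN : y ∈ N) by exact (fun_on_dom hZ hpi hy).
    assert (heq : forall z, rel F z x <-> rel F z y).
    { intro z. split; intro hz.
      - destruct (proj1 (proj2 hpi) z) as [u hu]; [apply (hdom z x hz) |].
        assert (huv : u ∈ v) by (apply (hc x v hx); eauto).
        apply (hc y v hy) in huv as (z' & hz' & hu').
        replace z with z'; [exact hz' |]. apply NNPP. intro k.
        apply (hm z); [| exact hz]. apply hD. split; [apply (hdom z x hz) |].
        exists z', u. auto.
      - destruct (proj1 (proj2 hpi) z) as [u hu]; [apply (hdom z y hz) |].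
        assert (huv : u ∈ v) by (apply (hc y v hy); eauto).
        apply (hc x v hx) in huv as (z' & hz' & hu').
        replace z with z'; [exact hz' |]. apply NNPP. intro k.
        apply (hm z'); [| exact hz']. apply hD. split; [apply (hdom z' x hz') |].
        exists z, u. auto. }
    specialize (hext (exist _ x hxN) (exist _ y hyN)).
    assert (e : exist (fun z => z ∈ N) x hxN = exist _ y hyN).
    { apply hext. intros [z hz]. apply heq. }
    now inversion e. }
  destruct (functional_choice (fun (x : internal_structure N F) v => rel pi (proj1_sig x) v))
    as [j hj].
  { intros [x hx]. exact (proj1 (proj2 hpi) x hx). }
  exists j. split; [| exact hj]. split; [| split].
  - intros x y h. pose proof (hj x) as h1. pose proof (hj y) as h2. rewrite <- h in h2.
    pose proof (hinj _ _ _ h1 h2) as e. destruct x as [x hx], y as [y hy].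
    cbn in e. subst y. f_equal. apply proof_irrelevance.
  - intros x y. cbn. rewrite (hc _ _ (hj y) (j x)). split.
    + intro h. exists (proj1_sig x). auto.
    + intros (x' & h & h'). now rewrite <- (hinj _ _ _ h' (hj x)).
  - intros y u hu. apply (hc _ _ (hj y)) in hu as (x & hx & hu).
    exists (exist _ x (proj1 (hdom x _ hx))).
    exact (proj2 (proj2 hpi) x _ _ hu (hj (exist _ x (proj1 (hdom x _ hx))))).
Qed.

(** The extension is taken of height at least [t + 1], to have [t] itself in the
    collapse. *)
Lemma unfoldable_reflects_subtle (k t : U) :
  unfoldable k -> subtle t -> exists t', t' ∈ k /\ subtle t'.
Proof.
  intros (hk & R & E & hR & hE & hunf) ht.
  apply (subtle_locally_subtle hZ) in ht.
  destruct (succ_exists hZ t) as [s hs], (empty_exists hZ) as [o ho].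
  destruct (hunf s o) as (N & F & P & h & hN & (hel & _ & _) & hwf & (pi & hpi & hh) & hsh).
  { exact (ordinal_succ (proj1 ht) hs). }
  { intros z hz. case (ho z hz). }
  pose proof (inclusion_embedding hE (level_transitive hZ hk hR)) as hjR.
  assert (hX : exists X : U, formula_closed X).
  { exists R. exact (level_formula_closed hZ hk hR). }
  assert (hne : exists a, a ∈ R).
  { exists o. exact (level_nat hZ hk hR (nat_zero ho)). }
  assert (hextN : extensional (internal_structure N F)).
  { apply (elementary_sentence hZ (M := R) (E := E) (S := o) (S' := P) (P := extensional)); auto.
    - unfold extensional. fo.
    - exact (embedding_extensional hjR). }
  destruct (collapse_embedding hN hwf hpi hextN) as (j & hj & hjpi).
  assert (hth : t ∈ h) by (apply hsh, hs; auto).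
  apply hh in hth as (_ & x & hx).
  assert (hxN : x ∈ N) by exact (fun_on_dom hZ (proj1 hpi) hx).
  assert (hjx : j (exist _ x hxN) = t).
  { exact (proj2 (proj2 (proj1 hpi)) x _ _ (hjpi (exist _ x hxN)) hx). }
  assert (hRt : exists t' : internal_structure R E, locally_subtle t').
  { apply NNPP. intro hn.
    apply (elementary_sentence hZ (M := R) (E := E) (S := o) (N := N) (F := F) (S' := P)
      (P := fun V => ~ exists t' : V, locally_subtle t')); auto.
    - fo.
    - exists (exist _ x hxN). apply (locally_subtle_down hj). now rewrite hjx. }
  destruct hRt as [[t' ht'R] ht'].
  assert (ho' : ordinal t').
  { exact (proj1 (emb_ordinal hjR (exist _ t' ht'R)) (proj1 ht')). }
  pose proof (level_ordinal hZ hR ht'R ho') as htk.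
  exists t'. split; [exact htk |]. apply (locally_subtle_subtle hZ).
  apply (locally_subtle_up hZ hjR) in ht'; [exact ht' | |].
  - cbn. intros C hC. exists (exist _ C (level_subset hZ hk hR htk hC)). reflexivity.
  - cbn. intros f hf. destruct (succ_exists hZ t') as [u hu].
    enough (hfR : f ∈ R) by (exists (exist _ f hfR); reflexivity).
    apply (level_relation hZ hk hR (inaccessible_limit hZ hk htk hu)).
    intros p hp. destruct (hf p hp) as (a & b & ha & hb & hab). exists a, b.
    assert (hbel : forall z, z ∈ t' -> below t' z).
    { intros z hz. exists z. split; [exact hz |].
      exact (ordinal_rank hZ (ordinal_elt ho' hz)). }
    split; [| split; [| exact hab]].
    + apply (below_mono (b := t')); [intros z hz; apply hu; auto | auto].
    + apply (below_succ hZ hk hR htk hu). auto.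
Qed.

End Reflection.

Theorem proposition2p4 (U : membership_structure) (hZFC : ZFC U)
    (hVL : V_equals_L U)
    (hunf : exists k : U, unfoldable k)
    (hsub : exists t : U, subtle t) :
  exists k t : U, is_first unfoldable k /\ is_first subtle t /\ t ∈ k.
Proof.
  destruct hunf as [k0 hk0], hsub as [t0 ht0].
  destruct (first_exists hZFC (Q := fun V x => unfoldable x) ltac:(fo) (k := k0))
    as (k & _ & hk); [apply hk0 | exact hk0 |].
  destruct (unfoldable_reflects_subtle hZFC (proj1 hk) ht0) as (t1 & ht1k & ht1).
  destruct (first_exists hZFC (Q := fun V x => subtle x) ltac:(fo) (k := t1))
    as (t & ht1t & ht); [apply ht1 | exact ht1 |].
  exists k, t. split; [exact hk | split; [exact ht |]].
  destruct ht1t as [h | ->]; [| exact ht1k].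
  assert (hok : ordinal k) by apply hk.
  exact (proj1 hok t1 ht1k t h).
Qed.
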